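(* Let $\mu\ge0$, let $n$ be a non-negative integer, and let $T:\mathbb{R}_n[z]\to\mathbb{R}[z]$ be a linear operator. Then $T(\mathcal{S}_\mu\cap\mathbb{R}_n[z])\subseteq\mathcal{S}_\mu(\mathbb{R})\cup\{0\}$ if and only if either (i) $T$ has rank at most $2$ over $\mathbb{R}$ and has the form $T(p)=\alpha(p)Q+\beta(p)R$, where $\alpha,\beta:\mathbb{R}_n[z]\to\mathbb{R}$ are linear functionals, $Q,R\in\mathbb{R}[z]$, and $Q+iR\in\mathcal{P}_\mu$; or (ii) either $T(\mathcal{P}_\mu\cap\mathbb{C}_n[z])\subseteq\mathcal{P}_\mu$ or $T(\mathcal{P}_\mu\cap\mathbb{C}_n[z])\subseteq\mathcal{P}_\mu^*$.
   Context: $\mathbb{R}_n[z]$, $\mathbb{C}_n[z]$ are the spaces of real, resp. complex, polynomials of degree at most $n$. $T$ is extended to $\mathbb{C}_n[z]=\mathbb{R}_n[z]\oplus i\mathbb{R}_n[z]$ by $T(u+iv)=T(u)+iT(v)$. $\mathcal{S}_\mu$ is the set of (nonzero) complex polynomials whose zeros all lie in $|\operatorname{Im}z|\le\mu$, and $\mathcal{S}_\mu(\mathbb{R})=\mathcal{S}_\mu\cap\mathbb{R}[z]$. For an entire function $f$, $f^*(z)=\overline{f(\bar z)}$. $\mathscr{D}_\mu$ is the set of entire functions $f$ with $|f(z)|>|f^*(z)|$ for all $\operatorname{Im}z>\mu$, $\overline{\mathscr{D}}_\mu$ is its closure under uniform limits on compact subsets of $\mathbb{C}$, and $\mathcal{P}_\mu=\overline{\mathscr{D}}_\mu\cap\mathbb{C}[z]$.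 For a set of polynomials $\mathcal{S}$, $\mathcal{S}^*=\{p^*:p\in\mathcal{S}\}$. *)

(* Defs.v *)
From HB Require Import structures.
From mathcomp Require Import all_boot all_order all_algebra.
From mathcomp Require Import complex.
From mathcomp Require Import all_classical all_reals all_analysis.

Set Implicit Arguments.
Unset Strict Implicit.
Unset Printing Implicit Defensive.

Import Order.TTheory GRing.Theory Num.Theory.
Import numFieldNormedType.Exports.

Local Open Scope classical_set_scope.
Local Open Scope complex_scope.
Local Open Scope ring_scope.

(* [R[i]^o] rather than [R[i]]: the normed-module structure of a field over
   itself is only inferred for the regular alias. *)
Definition entire (R : realType) (f : R[i]^o -> R[i]^o) : Prop :=
  forall z : R[i]^o, derivable f z 1.

Definition fun_star (R : realType) (f : R[i]^o -> R[i]^o) : R[i]^o -> R[i]^o :=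
  fun z => conjc (f (conjc z)).

(* The norms are elements of [R[i]] with zero imaginary part, so the (partial)
   order of [R[i]] restricts to the usual order of the reals on them. *)
Definition classD (R : realType) (mu : R) : set (R[i]^o -> R[i]^o) :=
  [set f | entire f /\
    forall z : R[i]^o, mu < complex.Im z -> `|fun_star f z| < `|f z|].

(* Closure for the topology of uniform convergence on compact sets. This is
   taken among all functions [R[i] -> R[i]]; locally uniform limits of entire
   functions being entire, the ambient space does not matter. *)
Definition classDbar (R : realType) (mu : R) : set (R[i]^o -> R[i]^o) :=
  closure (classD mu : set {family compact, R[i]^o -> R[i]^o}).

Definition classP (R : realType) (mu : R) : set {poly R[i]} :=
  [set p | classDbar mu (fun z => p.[z])].

Definition poly_star (R : realType) (p : {poly R[i]}) : {poly R[i]} :=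
  map_poly (@conjc R) p.

Definition set_star (R : realType) (S : set {poly R[i]}) : set {poly R[i]} :=
  [set poly_star p | p in S].

Definition polyC_of (R : realType) (p : {poly R}) : {poly R[i]} :=
  map_poly (real_complex R) p.

Definition classS (R : realType) (mu : R) : set {poly R[i]} :=
  [set p | p != 0 /\ forall z : R[i], root p z -> `|complex.Im z| <= mu].

Definition classSR (R : realType) (mu : R) : set {poly R} :=
  [set p | classS mu (polyC_of p)].

(* [{poly_n.+1 R}] is the space of polynomials of size at most [n.+1], that is,
   of degree at most [n]. [npolyp] truncates, but here its argument already has
   size at most [n.+1]; see [extendE]. *)
Definition extend (R : realType) (n : nat)
    (T : {linear {poly_n.+1 R} -> {poly R}}) (p : {poly_n.+1 R[i]}) :
    {poly R[i]} :=
  polyC_of (T (npolyp n.+1 (map_poly (@complex.Re R) p))) +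
  'i%C *: polyC_of (T (npolyp n.+1 (map_poly (@complex.Im R) p))).

(* No [k.+1] elements of the image are linearly independent. Stated this way
   because the codomain need not be finite-dimensional. *)
Definition rank_at_most (F : fieldType) (U V : lmodType F)
    (T : {linear U -> V}) (k : nat) : Prop :=
  forall u : 'I_k.+1 -> U, exists2 c : 'I_k.+1 -> F,
    exists i, c i != 0 & \sum_i c i *: T (u i) = 0.

Lemma extendE (R : realType) (n : nat)
    (T : {linear {poly_n.+1 R} -> {poly R}}) (u v : {poly_n.+1 R})
    (p : {poly_n.+1 R[i]}) :
  p = polyC_of u + 'i%C *: polyC_of v :> {poly R[i]} ->
  extend T p = polyC_of (T u) + 'i%C *: polyC_of (T v).
Proof.
move=> pE; rewrite /extend.
have -> : npolyp n.+1 (map_poly (@complex.Re R) p) = u.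
  apply/npolyP => i; rewrite coef_npolyp; case: ltnP => [_|le_n].
    rewrite coef_map_id0 // pE coefD coefZ !coef_map /=.
    by rewrite mul0r mulr0 subrr addr0.
  by rewrite big_coef_npoly.
have -> // : npolyp n.+1 (map_poly (@complex.Im R) p) = v.
apply/npolyP => i; rewrite coef_npolyp; case: ltnP => [_|le_n].
  rewrite coef_map_id0 // pE coefD coefZ !coef_map /=.
  by rewrite mul0r mul1r !add0r.
by rewrite big_coef_npoly.
Qed.

(* Main.v *)
Require Import Defs.
From HB Require Import structures.
From mathcomp Require Import all_boot all_order all_algebra.
From mathcomp Require Import complex ring lra zify.
From mathcomp Require Import all_classical all_reals all_analysis.

Set Implicit Arguments.
Unset Strict Implicit.
Unset Printing Implicit Defensive.

Import Order.TTheory GRing.Theory Num.Theory.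
Import numFieldNormedType.Exports.
Import ComplexField.Normc.

Local Open Scope classical_set_scope.
Local Open Scope complex_scope.
Local Open Scope ring_scope.

(** Write a polynomial as u + iv with u, v real.  By Hurwitz's theorem it belongs
    to P_mu exactly when every real combination au + bv is zero or has no zero
    in Im z > mu, and Im (u conj v) >= 0 there: a nonzero such polynomial p is
    the limit of the functions p (1 - i e z), which are in D_mu.

    If T preserves the real polynomials of S_mu (or 0), then u + iv in P_mu
    implies that the pencil of Tu, Tv is zero-free, so T(u + iv) is in P_mu or
    in P_mu^*, according to the sign of sigma = Im (Tu conj Tv) at one point z0
    of Im z > mu.  If sigma vanishes at some pair interior to the cone of pairs,
    then T kills an interior real polynomial q, hence T r = T (q + e r) / e is
    zero-free or zero for every r; evaluation at z0 is then injective on the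
    image of T, whose dimension is at most 2, and this is case (i).  Otherwise
    every u + iv in P_mu of degree n (a lower degree being raised by factors
    1 - i e z) is joined to a fixed interior pair by a path which is
    interior except at its origin, so that sigma has a constant sign: case (ii).
    For mu > 0 the path contracts the zeros and subtracts a multiple of v' from
    u; for mu = 0 it moves the zeros down into the open lower half-plane. *)

(** * Topology of the complex plane *)

Section ComplexTopology.
Variable R : realType.
Local Notation C := (R[i]^o).
Implicit Types z w : R[i].

Lemma norm_normc z : `|z| = (normc z)%:C.
Proof. by []. Qed.

Lemma Re_le_normc z : `|complex.Re z| <= normc z.
Proof.
case: z => x y /=; rewrite -sqrtr_sqr ler_sqrt ?addr_ge0 ?sqr_ge0//.
by rewrite lerDl sqr_ge0.
Qed.

Lemma Im_le_normc z : `|complex.Im z| <= normc z.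
Proof.
case: z => x y /=; rewrite -sqrtr_sqr ler_sqrt ?addr_ge0 ?sqr_ge0//.
by rewrite lerDr sqr_ge0.
Qed.

Lemma normc_ge0 z : 0 <= normc z.
Proof. by case: z => x y; exact: sqrtr_ge0. Qed.

Lemma normc_gt0 z : (0 < normc z) = (z != 0).
Proof.
rewrite lt_neqAle normc_ge0 andbT eq_sym; congr (~~ _).
by apply/eqP/eqP => [/eq0_normc|->]; rewrite ?normc0.
Qed.

Lemma normc_sqrE z : normc z ^+ 2 = complex.Re z ^+ 2 + complex.Im z ^+ 2.
Proof. by case: z => x y /=; rewrite sqr_sqrtr// addr_ge0 ?sqr_ge0. Qed.

Lemma normcBC z w : normc (z - w) = normc (w - z).
Proof. by rewrite -normcN opprB. Qed.

Lemma normc_conj z : normc (conjc z) = normc z.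
Proof. by case: z => x y /=; rewrite sqrrN. Qed.

Lemma normc_real (x : R) : normc x%:C = `|x|.
Proof. by rewrite /= expr0n addr0 sqrtr_sqr. Qed.

Lemma normcX z n : normc (z ^+ n) = normc z ^+ n.
Proof. by elim: n => [|n IH]; rewrite ?expr0 ?normc1// !exprS normcM IH. Qed.

Lemma ltr_normc z w : (`|z| < `|w|) = (normc z < normc w).
Proof. by rewrite !norm_normc ltcR. Qed.

Lemma gt0_complex (e : R[i]) : 0 < e -> exists2 r : R, 0 < r & e = r%:C.
Proof.
case: e => x y; rewrite ltcE /= => /andP[/eqP -> x0].
by exists x.
Qed.

Lemma nbhs_normcP (z : C) (A : set C) :
  nbhs z A <-> exists2 e : R, 0 < e & forall w, normc (w - z) < e -> A w.
Proof.
split=> [/nbhs_ballP[e /= e0 eA]|[e e0 eA]].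
  have [r r0 er] := gt0_complex e0; exists r => // w wz; apply: eA.
  by rewrite -ball_normE /ball_/= norm_normc er ltcR normcBC.
apply/nbhs_ballP; exists e%:C => /=; first by rewrite ltcR.
by move=> w; rewrite -ball_normE /ball_/= norm_normc ltcR normcBC; exact: eA.
Qed.

Lemma continuous_normcP (X : topologicalType) (f : X -> C) (x : X) :
  {for x, continuous f} <->
  forall e : R, 0 < e -> \forall y \near x, normc (f y - f x) < e.
Proof.
split=> [fx e e0|fx A /nbhs_normcP[e e0 eA]].
  have : nbhs (f x) [set w : C | normc (w - f x) < e].
    by apply/nbhs_normcP; exists e.
  by move=> /fx.
by have := fx e e0; apply: filterS => y; exact: eA.
Qed.

Lemma continuous_Re : continuous (@complex.Re R : C -> R).
Proof.
move=> z; apply/(@cvgrPdist_lt _ R^o _ _ (nbhs_filter (z : C))) => e e0.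
apply/nbhs_normcP; exists e => // w wz.
rewrite distrC (le_lt_trans _ wz)//; move: (Re_le_normc (w - z)).
by case: (w) (z) => [a b] [c d].
Qed.

Lemma continuous_Im : continuous (@complex.Im R : C -> R).
Proof.
move=> z; apply/(@cvgrPdist_lt _ R^o _ _ (nbhs_filter (z : C))) => e e0.
apply/nbhs_normcP; exists e => // w wz.
rewrite distrC (le_lt_trans _ wz)//; move: (Im_le_normc (w - z)).
by case: (w) (z) => [a b] [c d].
Qed.

Lemma continuous_real_complex : continuous (real_complex R : R -> C).
Proof.
move=> x; apply/continuous_normcP => e e0.
apply/nbhs_ballP; exists e => //= y; rewrite -ball_normE /ball_/= => xy.
by rewrite subrr expr0n addr0 sqrtr_sqr distrC.
Qed.

Lemma continuous_complex (X : topologicalType) (f g : X -> R) (x : X) :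
  {for x, continuous f} -> {for x, continuous g} ->
  {for x, continuous (fun y => (f y +i* g y : C))}.
Proof.
move=> fx gx.
have -> : (fun y => f y +i* g y : C) = (fun y => (f y)%:C + 'i * (g y)%:C : C).
  by apply/funext => y; rewrite [LHS]complexE.
apply: (@continuousD _ C).
  by apply: (continuous_comp fx); exact: continuous_real_complex.
apply: (@continuousM R[i]); first exact: cst_continuous.
by apply: (continuous_comp gx); exact: continuous_real_complex.
Qed.

Lemma continuous_conjc : continuous (@conjc R : C -> C).
Proof.
move=> z; have -> : (@conjc R : C -> C) =
  (fun w : C => complex.Re w +i* - complex.Im w) by apply/funext; case.
apply: continuous_complex; first exact: continuous_Re.
by apply: continuousN; exact: continuous_Im.
Qed.

Lemma continuous_normc : continuous (@normc R : C -> R).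
Proof.
move=> z; apply/(@cvgrPdist_lt _ R^o _ _ (nbhs_filter (z : C))) => e e0.
apply/nbhs_normcP; exists e => // w wz.
apply: le_lt_trans wz; rewrite ler_norml; apply/andP; split.
  by rewrite lerNl opprB lerBlDr (le_trans _ (le_normcD _ _))// subrK.
by rewrite lerBlDr normcBC (le_trans _ (le_normcD _ _))// subrK.
Qed.

Lemma derivable_hornerC (p : {poly R[i]}) (z : C) :
  derivable (fun w : C => p.[w] : C) z 1.
Proof.
elim/poly_ind: p => [|p c ih].
  rewrite (_ : (fun _ => _) = cst 0); first exact: derivable_cst.
  by apply/funext => w; rewrite horner0.
have idz : derivable (id : C -> C) z 1 by exact: derivable_id.
have cz : derivable (cst (c : C) : C -> C) z 1 by exact: derivable_cst.
have pX := @derivableM R[i] C (fun w => p.[w]) id z 1 ih idz.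
have pXc := @derivableD R[i] C C _ _ z 1 pX cz.
have -> : (fun w : C => (p * 'X + c%:P).[w] : C) = (fun w => p.[w] * w + c).
  by apply/funext => w; rewrite hornerMXaddC.
exact: pXc.
Qed.

Lemma entire_continuous (f : C -> C) : entire f -> continuous f.
Proof. by move=> fe z; apply/differentiable_continuous/derivable1_diffP/fe. Qed.

Lemma continuous_hornerC (p : {poly R[i]}) : continuous (fun w : C => p.[w] : C).
Proof. by apply: entire_continuous => z; exact: derivable_hornerC. Qed.

Definition square z (r : R) : set C :=
  [set w : C | `|complex.Re (w - z)| <= r /\ `|complex.Im (w - z)| <= r].

Lemma compact_square z r : compact (square z r).
Proof.
have -> : square z r =
   [set (z + (x.1 +i* x.2) : C) | x in (`[- r, r]%classic `*` `[- r, r]%classic)].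
  apply/seteqP; split=> w /=.
    move=> [wr wi]; exists (complex.Re (w - z), complex.Im (w - z)) => /=.
      by rewrite !in_itv /= -!ler_norml.
    rewrite (_ : complex.Re _ +i* _ = w - z); first by rewrite addrC subrK.
    by case: (w - z).
  case=> -[x y] /=; rewrite !in_itv /= -!ler_norml => -[xr yr] <-.
  by rewrite /square /= addrC addKr.
apply: continuous_compact.
  apply: continuous_subspaceT => -[x y].
  apply: (@continuousD _ C); first exact: cst_continuous.
  by apply: continuous_complex; [exact: cvg_fst|exact: cvg_snd].
by apply: compact_setX; exact: segment_compact.
Qed.

End ComplexTopology.
(** * Hurwitz's theorem for continuous approximations of a polynomial *)

Section Winding.
Variable R : realType.
Local Notation C := (R[i]^o).
Implicit Types z w : R[i].

(** Near each x of [K] all values of [f] lie within |f x| / 4 of f x, so two of them differ by less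
    than |f x| / 2 while each exceeds 3 |f x| / 4 in modulus. Compactness, in its near-covering
    form, makes the radius uniform. *)
Lemma compact_ratio_near1 (K : set C) (f : C -> C) :
  compact K -> continuous f -> (forall z, K z -> f z != 0) ->
  exists2 d : R, 0 < d & forall z w, K z -> normc (w - z) < d ->
    normc (f w - f z) < normc (f z).
Proof.
move=> cK fc f0.
move/compact_near_coveringP: cK => cK.
pose P d z := forall w, normc (w - z) < d -> normc (f w - f z) < normc (f z).
have /(filterI (nbhs_right_gt 0)) /filter_ex[d [/= d0 Pd]] :
    \forall d \near 0^'+, K `<=` P d.
  apply: cK => x Kx.
  have a0 : 0 < normc (f x) / 4 by rewrite divr_gt0// normc_gt0 f0.
  have /nbhs_normcP[e e0 fe] := (continuous_normcP f x).1 (fc x) _ a0.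
  exists ([set y : C | normc (y - x) < e / 2], [set d : R | d < e / 2]).
    split => /=; last by apply: nbhs_right_lt; rewrite divr_gt0.
    by apply/nbhs_normcP; exists (e / 2) => //; rewrite divr_gt0.
  move=> [y d] /= [yx de] w wy.
  have fy : normc (f y - f x) < normc (f x) / 4 by apply: fe; lra.
  have /fe fw : normc (w - x) < e.
    rewrite -(subrKA y w) (le_lt_trans (le_normcD _ _))//; lra.
  have : normc (f w - f y) <= normc (f w - f x) + normc (f y - f x).
    by rewrite -(subrKA (f x)) (normcBC (f y)) le_normcD.
  have : normc (f x) <= normc (f y) + normc (f y - f x).
    by rewrite (normcBC (f y)) (le_trans _ (le_normcD _ _))// addrC subrK.
  lra.
by exists d => // z w Kz; exact: Pd.
Qed.

(* [F] is a positive function times a constant times e^(i th) for a th which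
   takes the same value at 0 and 2 pi: the closed curve [F] does not wind
   around 0. *)
Definition liftable (F : R -> R[i]) := exists (th rho : R -> R) (c : R[i]),
  [/\ continuous th, th (2 * pi) = th 0, c != 0, (forall t, 0 < rho t) &
   forall t, F t = (rho t)%:C * c * (cos (th t) +i* sin (th t))].

Lemma polar_atan z : 0 < complex.Re z ->
  z = (normc z)%:C *
    (cos (atan (complex.Im z / complex.Re z)) +i*
     sin (atan (complex.Im z / complex.Re z))).
Proof.
case: z => x y /= x0; set a := atan _.
have ta : tan a = y / x by rewrite atanK.
have ca : cos a = (Num.sqrt (1 + (y / x) ^+ 2))^-1 by rewrite cos_atan.
have s0 : 0 < Num.sqrt (1 + (y / x) ^+ 2).
  by rewrite sqrtr_gt0 ltr_pwDl// sqr_ge0.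
have sa : sin a = (y / x) * cos a.
  by rewrite -ta /tan mulfVK// ca invr_neq0// gt_eqF.
have -> : Num.sqrt (x ^+ 2 + y ^+ 2) = x * Num.sqrt (1 + (y / x) ^+ 2).
  rewrite -[X in X * _](ger0_norm (ltW x0)) -sqrtr_sqr -sqrtrM ?sqr_ge0//.
  congr Num.sqrt; field; exact: lt0r_neq0.
rewrite sa ca; set s := Num.sqrt _ in s0 *.
simpc; congr (_ +i* _); field; rewrite ?(lt0r_neq0 s0) ?(lt0r_neq0 x0)//.
Qed.

(** A form of Rouché's theorem: F conj G stays in the right half-plane, so F / G has a continuous
    argument given by [atan], equal at both ends of the period; it is added to the argument of G. *)
Lemma liftable_near (F G : R -> C) :
  continuous F -> continuous G -> F (2 * pi) = F 0 -> G (2 * pi) = G 0 ->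
  (forall t, 0 < complex.Re (F t * conjc (G t))) ->
  liftable G -> liftable F.
Proof.
move=> Fc Gc F2 G2 FG [th [rho [c [thc th2 c0 rho0 GE]]]].
pose h t := F t * conjc (G t).
pose a t := complex.Im (h t) / complex.Re (h t).
have hc : continuous (h : R -> C).
  move=> t; apply: (@continuousM R[i] R); first exact: Fc.
  by apply: (continuous_comp (Gc t)); exact: continuous_conjc.
have G0 t : G t != 0.
  by apply: contraTneq (FG t) => ->; rewrite conjc0 mulr0 ltxx.
exists (fun t => th t + atan (a t)),
  (fun t => rho t * normc (h t) / normc (G t) ^+ 2), c; split => //.
- move=> t; apply: continuousD; first exact: thc.
  apply: (@continuous_comp _ _ _ a atan); last exact: continuous_atan.
  apply: continuousM.
    by apply: (continuous_comp (hc t)); exact: continuous_Im.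
  apply: continuousV; first exact: lt0r_neq0 (FG t).
  by apply: (continuous_comp (hc t)); exact: continuous_Re.
- by rewrite th2 /a /h F2 G2.
- move=> t; rewrite divr_gt0 ?exprn_gt0 ?mulr_gt0 ?normc_gt0//.
  by apply: contraTneq (FG t) => h0; rewrite -/(h t) h0 ltxx.
- move=> t.
  have hE := polar_atan (FG t); rewrite -/(h t) -/(a t) in hE.
  have GG : conjc (G t) * G t = (normc (G t) ^+ 2)%:C.
    by rewrite normc_sqrE; case: (G t) => x y; simpc; congr (_ +i* _); ring.
  have n0 : (normc (G t) ^+ 2)%:C != 0 :> R[i].
    by rewrite -GG mulf_neq0 ?conjc_eq0.
  apply: (mulIf n0); rewrite -{1}GG mulrA -/(h t) {1}hE {1}GE.
  move: n0; set n := normc (G t) ^+ 2 => n0.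
  have -> : (rho t * normc (h t) / n)%:C =
      (rho t)%:C * (normc (h t))%:C / n%:C :> R[i].
    by rewrite -fmorphV -!rmorphM.
  rewrite cosD sinD.
  have -> : (cos (th t) * cos (atan (a t)) - sin (th t) * sin (atan (a t))) +i*
     (sin (th t) * cos (atan (a t)) + cos (th t) * sin (atan (a t))) =
     (cos (th t) +i* sin (th t)) * (cos (atan (a t)) +i* sin (atan (a t))).
    by simpc; congr (_ +i* _); ring.
  by field.
Qed.

(** If th lifted the curve, psi would run continuously from 0 to 2 pi m and take the value pi,
    although e^(i psi) is always a positive real. *)
Lemma expi_nat_not_liftable (m : nat) (a : R[i]) : (0 < m)%N ->
  ~ liftable (fun t => a * (cos t +i* sin t) ^+ m).
Proof.
move=> m0 [th [rho [c [thc th2 c0 rho0 E]]]].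
have expiX t : (cos t +i* sin t) ^+ m = cos (m%:R * t) +i* sin (m%:R * t) :> R[i].
  elim: (m) => [|k IH]; first by rewrite expr0 mul0r cos0 sin0.
  rewrite exprSr IH -natr1 mulrDl mul1r cosD sinD; simpc.
  by congr (_ +i* _); rewrite addrC.
pose psi t := m%:R * t - (th t - th 0).
have a0 : a = (rho 0)%:C * c * (cos (th 0) +i* sin (th 0)).
  by rewrite -E cos0 sin0 expr1n mulr1.
have psic : {within `[0, 2 * pi], continuous psi}.
  apply: continuous_subspaceT => t; apply: continuousB.
    by apply: continuousM; [exact: cst_continuous|].
  by apply: continuousB; [exact: thc|exact: cst_continuous].
have pi0 : 0 < pi :> R by exact: pi_gt0.
have psi0 : psi 0 = 0 by rewrite /psi; ring.
have psi2 : psi (2 * pi) = m%:R * (2 * pi) by rewrite /psi th2; ring.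
have m1 : 1 <= m%:R :> R by rewrite ler1n.
have [||t _ psit] := IVT (v := pi) _ psic; first by nra.
  rewrite psi0 psi2 min_l ?max_r; nra.
have {}E : (cos (psi t) +i* sin (psi t)) * (rho 0)%:C = (rho t)%:C :> R[i].
  have e1 s : (cos s +i* sin s) * (cos s -i* sin s) = 1 :> R[i].
    by simpc; rewrite -!expr2 cos2Dsin2 mulrC addrC subrr.
  have := E t; rewrite expiX a0 => Et.
  apply: (mulIf c0); apply: (mulIf (_ : cos (th t) +i* sin (th t) != 0)).
    apply/negP => /eqP e0; have := e1 (th t); rewrite e0 mul0r => /eqP.
    by rewrite eq_sym oner_eq0.
  rewrite -Et.
  have -> : cos (psi t) +i* sin (psi t) = (cos (m%:R * t) +i* sin (m%:R * t)) *
     (cos (th 0) +i* sin (th 0)) * (cos (th t) -i* sin (th t)).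
    rewrite /psi opprB addrA !(cosD, sinD) cosN sinN; simpc.
    by congr (_ +i* _); ring.
  rewrite -[RHS]mulr1 -(e1 (th t)); ring.
move: E; rewrite psit cospi sinpi => -[]; rewrite mulN1r !mul0r subr0 => r0 _.
have := rho0 t; have := rho0 0; lra.
Qed.

End Winding.

(** * Zeros of continuous functions close to a polynomial *)

Section Hurwitz.
Variable R : realType.
Local Notation C := (R[i]^o).
Implicit Types z w : R[i].

Lemma Re_mul_conj_gt0 z w : normc (w - z) < normc z ->
  0 < complex.Re (w * conjc z).
Proof.
move=> wz; have : normc (w - z) ^+ 2 < normc z ^+ 2.
  by rewrite ltr_pXn2r ?nnegrE ?normc_ge0.
rewrite !normc_sqrE; case: z w {wz} => [a b] [c d] /=; nra.
Qed.

Definition circle z (r t : R) : C := z + r%:C * (cos t +i* sin t).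

Lemma continuous_circle z r : continuous (circle z r).
Proof.
move=> t; apply: (@continuousD _ C); first exact: cst_continuous.
apply: (@continuousM R[i] R); first exact: cst_continuous.
by apply: continuous_complex; [exact: continuous_cos|exact: continuous_sin].
Qed.

Lemma circle_periodic z r : circle z r (2 * pi) = circle z r 0.
Proof. by rewrite /circle mulr_natl cos2pi sin2pi cos0 sin0. Qed.

Lemma normc_expi (t : R) : normc (cos t +i* sin t) = 1.
Proof. by rewrite /= cos2Dsin2 sqrtr1. Qed.

Lemma circle_square z (s r t : R) : 0 <= s <= r -> square z r (circle z s t).
Proof.
move=> /andP[s0 sr]; have n : normc (circle z s t - z) <= r.
  by rewrite addrC addKr normcM normc_real normc_expi mulr1 ger0_norm.
by split; rewrite (le_trans _ n) ?Re_le_normc ?Im_le_normc.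
Qed.

(* The ratios of the values of f on consecutive concentric circles are close
   to 1, so their arguments are continuous and add up. *)
Lemma nonvanishing_liftable (f : C -> C) z (r : R) : 0 < r -> continuous f ->
  (forall w, square z r w -> f w != 0) -> liftable (f \o circle z r).
Proof.
move=> r0 fc f0.
have [d d0 fd] := compact_ratio_near1 (@compact_square _ z r) fc f0.
have [N rN] : exists N : nat, r / d < N%:R.
  by exists (Num.bound (r / d)); rewrite archi_boundP// divr_ge0// ltW.
have N0 : 0 < N%:R :> R by rewrite (lt_trans _ rN)// divr_gt0.
have G j : (j <= N)%N -> liftable (f \o circle z (j%:R / N%:R * r)).
  elim: j => [_|j IH jN].
    exists (fun=> 0), (fun=> 1), (f z); split => //.
    - by move=> t; exact: cst_continuous.
    - by apply: f0; split; rewrite subrr normr0 ltW.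
    - by move=> t; rewrite /circle /= !mul0r addr0 mul1r cos0 sin0 mulr1.
  have cc s : continuous (f \o circle z s).
    by move=> t; apply: continuous_comp; [exact: continuous_circle|exact: fc].
  have jj : 0 <= j%:R / N%:R * r <= r.
    rewrite mulr_ge0 ?(ltW r0) ?divr_ge0//= ger_pMl// ler_pdivrMr// mul1r.
    by rewrite ler_nat ltnW.
  apply: liftable_near (IH (ltnW jN)) => //; rewrite /= ?circle_periodic// => t.
  apply/Re_mul_conj_gt0/fd; first exact: circle_square.
  rewrite /circle opprD addrACA subrr add0r -mulrBl -rmorphB normcM normc_expi.
  rewrite mulr1 normc_real -natr1 mulrDl mulrDl addrC addKr mul1r.
  rewrite ger0_norm; last by rewrite mulr_ge0 ?invr_ge0 ?ltW.
  by rewrite mulrC ltr_pdivrMr// mulrC -ltr_pdivrMr.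
by have := G N (leqnn N); rewrite divff ?mul1r ?gt_eqF.
Qed.

(** Near a zero z of multiplicity m, p w is close to a (w - z)^m with a nonzero. An f close to p
    without zeros in the square would be liftable along the circle, hence so would a (w - z)^m,
    which winds m times. *)
Lemma hurwitz_poly (p : {poly R[i]}) z (eta : R) : p != 0 -> root p z ->
  0 < eta -> exists r e : R, [/\ 0 < r < eta, 0 < e &
    forall f : C -> C, continuous f ->
     (forall w, square z r w -> normc (f w - p.[w]) < e) ->
     exists2 w, square z r w & f w = 0].
Proof.
move=> p0 pz eta0.
have [m [q qz pE]] := multiplicity_XsubC p z.
rewrite p0 /= in qz; set a := q.[z]; have a0 : a != 0 by [].
have m0 : (0 < m)%N.
  case: m pE => // pE; move: pz; rewrite pE expr0 mulr1 => /(negP qz)[].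
have na : 0 < normc a / 2 by rewrite divr_gt0 ?normc_gt0.
have /nbhs_normcP[d d0 qd] :=
  (continuous_normcP _ _).1 (@continuous_hornerC _ q z) _ na.
pose r := Num.min (d / 2) (eta / 2).
have r0 : 0 < r by rewrite lt_min !divr_gt0.
have rd : r < d by rewrite gt_min; apply/orP; left; lra.
(* On the circle, f - p and p - a (w - z)^m each get one half of r^m |a|, the modulus of a (w -
   z)^m. *)
exists r, (r ^+ m * (normc a / 2)); split.
- by rewrite r0 gt_min; apply/orP; right; lra.
- by rewrite mulr_gt0 ?exprn_gt0.
move=> f fc fp; apply: contrapT => nof.
have fl : liftable (f \o circle z r).
  apply: nonvanishing_liftable => // w ws; apply/negP => /eqP fw.
  by apply: nof; exists w.
apply: (@expi_nat_not_liftable _ _ (a * r%:C ^+ m) m0).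
have -> : (fun t => a * r%:C ^+ m * (cos t +i* sin t) ^+ m) =
   (fun w => a * (w - z) ^+ m) \o circle z r.
  by apply/funext => t; rewrite /= /circle [z + _]addrC addrK exprMn mulrA.
have gc : continuous (fun w : C => a * (w - z) ^+ m : C).
  have := @continuous_hornerC _ (a *: ('X - z%:P) ^+ m).
  rewrite (_ : (fun w => (a *: ('X - z%:P) ^+ m).[w]) =
    (fun w => a * (w - z) ^+ m))//.
  by apply/funext => w; rewrite !hornerE.
apply: liftable_near fl.
- by move=> t; apply: continuous_comp; [exact: continuous_circle|exact: gc].
- by move=> t; apply: continuous_comp; [exact: continuous_circle|exact: fc].
- by rewrite /= circle_periodic.
- by rewrite /= circle_periodic.
move=> t; set w := circle z r t.
have wz : normc (w - z) = r.
  by rewrite /w /circle [z + _]addrC addrK normcM normc_expi mulr1 normc_real gtr0_norm.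
have -> : (fun w => a * (w - z) ^+ m) (circle z r t) * conjc ((f \o circle z r) t) =
   conjc (f w * conjc (a * (w - z) ^+ m)).
  rewrite /= -/w; move: (f w) (a * _) => [x1 y1] [x2 y2]; simpc.
  by congr (_ +i* _); ring.
have -> : forall x : R[i], complex.Re (conjc x) = complex.Re x by case.
apply: Re_mul_conj_gt0.
have fw : normc (f w - p.[w]) < r ^+ m * (normc a / 2).
  by apply/fp/circle_square; rewrite lexx ltW.
have qw : normc (q.[w] - a) < normc a / 2 by apply: qd; rewrite wz.
have pw : normc (p.[w] - a * (w - z) ^+ m) = normc (q.[w] - a) * r ^+ m.
  by rewrite pE !hornerE -mulrBl normcM normcX wz.
have rm : 0 < r ^+ m by rewrite exprn_gt0.
rewrite -(subrKA p.[w]) (le_lt_trans (le_normcD _ _))// pw normcM normcX wz.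
nra.
Qed.

End Hurwitz.
(** * The class P_mu in terms of real and imaginary parts *)

Section HermiteBiehler.
Variable R : realType.
Local Notation C := (R[i]^o).
Implicit Types (z w : R[i]) (u v p q : {poly R}) (mu : R).

Definition cev p z : R[i] := (polyC_of p).[z].

Definition cpoly u v : {poly R[i]} := polyC_of u + 'i%C *: polyC_of v.

(* A quarter of |p|^2 - |p^*|^2 for p = u + iv. *)
Definition wr u v z : R := complex.Im (cev u z * conjc (cev v z)).

Definition zfree mu q := forall z, mu < complex.Im z -> cev q z != 0.

Definition pencil_zfree mu u v :=
  forall a b : R, a *: u + b *: v = 0 \/ zfree mu (a *: u + b *: v).

(** The real form of membership of u + iv in P_mu, in the spirit of Hermite and Biehler: see
    [classP_hb] and [hb_pair_classP]. *)
Definition hb_pair mu u v :=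
  pencil_zfree mu u v /\ forall z, mu < complex.Im z -> 0 <= wr u v z.

Lemma polyC_ofD p q : polyC_of (p + q) = polyC_of p + polyC_of q.
Proof. exact: rmorphD. Qed.

Lemma polyC_ofZ (a : R) p : polyC_of (a *: p) = a%:C *: polyC_of p.
Proof. exact: map_polyZ. Qed.

Lemma polyC_of_eq0 p : (polyC_of p == 0) = (p == 0).
Proof. by rewrite -[0](rmorph0 (map_poly (real_complex R))) (inj_eq (map_poly_inj _)). Qed.

Lemma cev0 z : cev 0 z = 0.
Proof. by rewrite /cev /polyC_of rmorph0 horner0. Qed.

Lemma cevD p q z : cev (p + q) z = cev p z + cev q z.
Proof. by rewrite /cev polyC_ofD hornerD. Qed.

Lemma cevZ a p z : cev (a *: p) z = a%:C * cev p z.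
Proof. by rewrite /cev polyC_ofZ hornerZ. Qed.

Lemma cevN p z : cev (- p) z = - cev p z.
Proof. by rewrite -scaleN1r cevZ rmorphN1 mulN1r. Qed.

Lemma cevM p q z : cev (p * q) z = cev p z * cev q z.
Proof. by rewrite /cev /polyC_of rmorphM hornerM. Qed.

Lemma cevX z : cev 'X z = z.
Proof. by rewrite /cev /polyC_of map_polyX hornerX. Qed.

Lemma cev_conj p z : cev p (conjc z) = conjc (cev p z).
Proof.
rewrite /cev !horner_coef rmorph_sum/=; apply: eq_bigr => i _.
by rewrite rmorphM rmorphXn /= coef_map /= oppr0.
Qed.

Lemma cev_sum (I : Type) (r : seq I) (P : pred I) (F : I -> {poly R}) z :
  cev (\sum_(i <- r | P i) F i) z = \sum_(i <- r | P i) cev (F i) z.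
Proof. by rewrite /cev /polyC_of rmorph_sum horner_sum. Qed.

Lemma horner_cpoly u v z : (cpoly u v).[z] = cev u z + 'i * cev v z.
Proof. by rewrite hornerD hornerZ. Qed.

Lemma fun_star_cpoly u v z :
  fun_star (fun z : C => (cpoly u v).[z] : C) z = cev u z - 'i * cev v z.
Proof.
rewrite /fun_star horner_cpoly !cev_conj.
by case: (cev u z) (cev v z) => [a b] [c d]; simpc; congr (_ +i* _); ring.
Qed.

Lemma cpoly_normE z w :
  normc (z + 'i * w) ^+ 2 - normc (z - 'i * w) ^+ 2 =
  4 * complex.Im (z * conjc w).
Proof. by rewrite !normc_sqrE; case: z w => [a b] [c d] /=; ring. Qed.

Lemma classD_approx mu (F : C -> C) : classDbar mu F ->
  forall (K : set C) (e : R), compact K -> 0 < e ->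
  exists2 f, classD mu f & forall z, K z -> normc (f z - F z) < e.
Proof.
move=> DF K e cK e0.
pose E : set (C * C) := [set xy | normc (xy.2 - xy.1) < e].
have entE : entourage E.
  rewrite -entourage_ballE; exists e%:C => /=; first by rewrite ltcR.
  move=> [x y] /=; rewrite -ball_normE /ball_/= norm_normc ltcR normcBC.
  exact.
have [f [fD fK]] := DF _ (@fam_nbhs C C compact K E F entE cK).
by exists f => // z Kz; exact: fK.
Qed.


(** The inequality passes to the limit pointwise. For the pencil, a u + b v = A P + conj A P^* with
    A = (a - ib) / 2; approximating P by f in D_mu, Hurwitz yields a zero w of A f + conj A f^*
    above mu, where |f w| = |f^* w|, which D_mu forbids. *)
Lemma classP_hb mu u v : classP mu (cpoly u v) -> hb_pair mu u v.
Proof.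
rewrite /classP /=; set P := fun z => _; move=> DP.
have wr_ge0 z : mu < complex.Im z -> 0 <= wr u v z.
  move=> muz; have : normc (fun_star P z) <= normc (P z).
    rewrite leNgt; apply/negP => PP.
    (* Half of the gap: the errors at z and at conj z, where f^* reads f, together cannot close
       it. *)
    pose e := (normc (fun_star P z) - normc (P z)) / 2.
    have e0 : 0 < e by rewrite /e; lra.
    have cK : compact [set (conjc z : C)] by exact: compact_set1.
    have cK' : compact [set (z : C)] by exact: compact_set1.
    have [f [fe fD] fP] := classD_approx DP (compactU cK cK') e0.
    have f1 := fP z (or_intror erefl).
    have f2 := fP (conjc z) (or_introl erefl).
    have := fD z muz; rewrite ltr_normc.
    have : normc (f z) <= normc (f z - P z) + normc (P z).
      by rewrite (le_trans _ (le_normcD _ _))// subrK.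
    have : normc (fun_star P z) <= normc (f (conjc z) - P (conjc z)) + normc (fun_star f z).
      rewrite -(normc_conj (_ - _)) rmorphB/= -/(fun_star f z) -/(fun_star P z).
      by rewrite normcBC (le_trans _ (le_normcD _ _))// subrK.
    rewrite /e in f1 f2; lra.
  rewrite -(ler_pXn2r (_ : (0 < 2)%N)) ?nnegrE ?normc_ge0//.
  rewrite fun_star_cpoly /P horner_cpoly -subr_ge0 cpoly_normE; lra.
split => // a b.
have [->|q0] := eqVneq (a *: u + b *: v) 0; [by left|right => z muz].
set q := _ + _ in q0 *.
apply/negP => /eqP qz.
have eta0 : 0 < complex.Im z - mu by rewrite subr_gt0.
have q0' : polyC_of q != 0 by rewrite polyC_of_eq0.
have rq : root (polyC_of q) z by exact/eqP.
have [r [e [/andP[r0 re] e0 H]]] := hurwitz_poly q0' rq eta0.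
pose A : R[i] := (a / 2) -i* (b / 2).
have cK := @compact_square _ z r.
have cK' : compact (@conjc R @` (square z r) : set C).
  apply: continuous_compact cK.
  by apply: continuous_subspaceT => x; exact: continuous_conjc.
have nA : 0 <= normc A by exact: normc_ge0.
(* Each of the two terms of the combination has an error of at most |A| times this, in all less than
   e. *)
have d0 : 0 < e / (2 * (normc A + 1)).
  by rewrite divr_gt0// mulr_gt0//; lra.
have [f [fe fD] fP] := classD_approx DP (compactU cK cK') d0.
have fc := entire_continuous fe.
have A0 : A != 0.
  apply: contraNneq q0 => -[] a0 b0; 
  have aE : a = 0 by lra.
  have bE : b = 0 by lra.
  by rewrite /q aE bE !scale0r addr0.
have gc : continuous (fun y : C => A * f y + conjc A * fun_star f y : C).
  have fsc : continuous (fun_star f).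
    have cjc := @continuous_conjc R.
    move=> x; apply: (@continuous_comp C C C (f \o @conjc R) (@conjc R)).
      exact: (continuous_comp (cjc x) (fc _)).
    exact: cjc.
  move=> x; have fx : {for x, continuous (fun y : C => A * f y : C)}.
    by apply: (@continuousM R[i] C); [exact: cst_continuous|exact: fc].
  have fsx : {for x, continuous (fun y : C => conjc A * fun_star f y : C)}.
    by apply: (@continuousM R[i] C); [exact: cst_continuous|exact: fsc].
  exact: (continuousD fx fsx).
have [w ws|w ws] := H _ gc.
- have qE : (polyC_of q).[w] = A * P w + conjc A * fun_star P w.
    rewrite fun_star_cpoly /P horner_cpoly -/(cev q w) cevD !cevZ /A.
    by case: (cev u w) (cev v w) => [? ?] [? ?]; simpc; congr (_ +i* _); field.
  rewrite qE opprD addrACA -!mulrBr (le_lt_trans (le_normcD _ _))//.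
  rewrite !normcM normc_conj.
  have f1 := fP w (or_introl ws).
  have : normc (fun_star f w - fun_star P w) < e / (2 * (normc A + 1)).
    rewrite -rmorphB normc_conj; apply: fP; right; by exists w.
  move: f1; rewrite !ltr_pdivlMr; nra.
move=> /eqP; rewrite addr_eq0 => /eqP E.
have muw : mu < complex.Im w.
  case: ws => _; rewrite ler_norml => /andP[+ _].
  by move: re; case: (w) (z) => [? ?] [? ?] /=; lra.
have := fD w muw; rewrite ltr_normc.
have : normc A * normc (f w) = normc A * normc (fun_star f w).
  by rewrite -normcM E normcN normcM normc_conj.
move/mulfI => ->; first by rewrite ltxx.
by rewrite gt_eqF// normc_gt0.
Qed.

End HermiteBiehler.

(** * From the conditions on real and imaginary parts back to P_mu *)

Section ClassP.
Variable R : realType.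
Local Notation C := (R[i]^o).
Implicit Types (z : R[i]) (u v p q : {poly R}) (mu : R).

(** [h] is bounded on each compact set, so g + e h tends to g uniformly there as e tends to 0 from
    the right. *)
Lemma classDbar_lim mu (g h : {poly R[i]}) :
  (forall e : R, 0 < e -> classD mu (fun z : C => (g + e%:C *: h).[z] : C)) ->
  classP mu g.
Proof.
move=> D; rewrite /classP /classDbar /=.
pose F (e : R) (z : C) : C := (g + e%:C *: h).[z].
have Fg : {family compact, F e @[e --> 0^'+] --> (fun z : C => g.[z] : C)}.
  apply/fam_cvgP => K cK B /uniform_nbhs[E [entE EB]].
  move: entE; rewrite -entourage_ballE => -[_ /gt0_complex[e e0 ->] eE].
  have [M [_ hM]] : bounded_set ((fun z : C => normc h.[z]) @` K).
    apply: compact_bounded; apply: continuous_compact cK.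
    apply: continuous_subspaceT => x.
    exact: (continuous_comp (@continuous_hornerC _ h x) (@continuous_normc _ _)).
  have M1 : 0 < `|M| + 1 by have := normr_ge0 M; lra.
  have d0 : 0 < e / (`|M| + 1) by rewrite divr_gt0.
  suff : \forall d \near 0^'+, B (F d) by [].
  near=> d; apply: EB => z Kz; apply: eE.
  rewrite -ball_normE /ball_/= norm_normc ltcR normcBC /F hornerD hornerZ addrC addKr.
  have nh : normc h.[z] <= `|M| + 1.
    rewrite -[normc _]ger0_norm ?normc_ge0//; apply: (hM (`|M| + 1)); last by exists z.
    by rewrite (le_lt_trans (ler_norm M))// ltrDl.
  have dd : 0 < d by near: d; exact: nbhs_right_gt.
  have de : d < e / (`|M| + 1) by near: d; exact: nbhs_right_lt.
  rewrite normcM normc_real gtr0_norm// (le_lt_trans (ler_wpM2l (ltW dd) nh))//.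
  by rewrite -ltr_pdivlMr.
move=> B /Fg /= FB; have {}FB : \forall e \near 0^'+, B (F e) by [].
move: FB => /(filterI (nbhs_right_gt 0)) /filter_ex[e [/= e0 Be]].
by exists (F e); split => //; exact: D.
Unshelve. all: by end_near. Qed.

(** A vanishing real combination makes the two values collinear over the reals, so [wr] is 0 unless
    a = b = 0; the two products express this without a case distinction. *)
Lemma wr_root (a b : R) u v z :
  cev (a *: u + b *: v) z = 0 -> a * wr u v z = 0 /\ b * wr u v z = 0.
Proof.
rewrite cevD !cevZ /wr; case: (cev u z) (cev v z) => [x1 y1] [x2 y2].
move/eqP; rewrite eq_complex /= => /andP[/eqP H1 /eqP H2]; split.
  have -> : a * (x1 * - y2 + y1 * x2) =
    x2 * (a * y1 + 0 * x1 + (b * y2 + 0 * x2)) -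
    y2 * (a * x1 - 0 * y1 + (b * x2 - 0 * y2)) by ring.
  by rewrite H1 H2 !mulr0 subr0.
have -> : b * (x1 * - y2 + y1 * x2) =
  y1 * (a * x1 - 0 * y1 + (b * x2 - 0 * y2)) -
  x1 * (a * y1 + 0 * x1 + (b * y2 + 0 * x2)) by ring.
by rewrite H1 H2 !mulr0 subr0.
Qed.

Lemma strict_hb_pair mu u v :
  (forall z, mu < complex.Im z -> 0 < wr u v z) -> hb_pair mu u v.
Proof.
move=> uv; split => [a b|z /uv/ltW//].
have [q0|q0] := eqVneq (a *: u + b *: v) 0; [by left|right => z /uv wz].
apply: contra_neq q0 => /wr_root[/eqP + /eqP].
by rewrite !mulf_eq0 !(gt_eqF wz) !orbF => /eqP -> /eqP ->; rewrite !scale0r addr0.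
Qed.

(** At such a zero [wr] equals - |v z|^2, so both values vanish; then every member of the pencil has
    a zero above mu and is 0. *)
Lemma hb_pair_root mu u v z : hb_pair mu u v -> mu < complex.Im z ->
  cev u z + 'i * cev v z = 0 -> cpoly u v = 0.
Proof.
move=> [uv wr0] muz E; have := wr0 z muz; rewrite /wr.
have cu : cev u z = - 'i * cev v z by apply/eqP; rewrite mulNr -addr_eq0 E.
rewrite cu => W; have v0 : cev v z = 0.
  move: W; case: (cev v z) => a b; simpc => /= W; apply/eqP.
  rewrite eq_complex /=; apply/andP; split; apply/eqP; nra.
have u0 : cev u z = 0 by rewrite cu v0 mulr0.
have w a b : a *: u + b *: v = 0.
  by have [//|/(_ z muz)] := uv a b; rewrite cevD !cevZ u0 v0 !mulr0 addr0 eqxx.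
have uE : u = 0 by have := w 1 0; rewrite scale1r scale0r addr0.
have vE : v = 0 by have := w 0 1; rewrite scale1r scale0r add0r.
by rewrite /cpoly uE vE /polyC_of rmorph0 scaler0 addr0.
Qed.

Lemma cev1 z : cev 1 z = 1 :> R[i].
Proof. by rewrite /cev /polyC_of rmorph1 hornerC. Qed.

Lemma entire_horner (p : {poly R[i]}) : entire (fun z : C => p.[z] : C).
Proof. by move=> z; exact: derivable_hornerC. Qed.

Lemma normc_lt_of_sqr (x y : R[i]) : normc x ^+ 2 < normc y ^+ 2 -> normc x < normc y.
Proof. by rewrite ltr_pXn2r ?nnegrE ?normc_ge0. Qed.

(** Multiplying by 1 - i e z makes the weak inequality strict: |1 - i e z| > |1 + i e z| for Im z >
    0, and a nonzero u + iv has no zero above mu. *)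
Lemma hb_pair_classP mu u v : 0 <= mu -> hb_pair mu u v -> classP mu (cpoly u v).
Proof.
move=> mu0 uv; pose L (e : R) z := 1 + e%:C * ('i * - z).
have LE (e : R) z : 0 < e -> mu < complex.Im z ->
    0 <= normc (conjc (L e (conjc z))) ^+ 2 < normc (L e z) ^+ 2.
  move=> e0 muz; rewrite sqr_ge0 /L !normc_sqrE.
  case: z muz => x y /= muy; have : 0 < e * y by rewrite mulr_gt0//; lra.
  nra.
(* The zero polynomial, which no factor moves into D_mu, is the limit of e (1 - i z). *)
have [p0|p0] := eqVneq (cpoly u v) 0.
  rewrite p0; apply: (@classDbar_lim mu 0 (cpoly 1 (- 'X))) => e e0.
  split; first exact: entire_horner.
  move=> z muz; rewrite ltr_normc; apply: normc_lt_of_sqr.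
  rewrite /fun_star !hornerD !horner0 !add0r !hornerZ !horner_cpoly !cevN !cevX !cev1.
  have LE1 w : 1 + 'i * - w = L 1 w by rewrite /L mul1r.
  rewrite !LE1 rmorphM !normcM !exprMn normc_conj ltr_pM2l.
    by have /andP[] := LE 1 z ltr01 muz.
  by rewrite exprn_gt0// normc_real gtr0_norm.
apply: (@classDbar_lim mu _ (cpoly u v * cpoly 0 (- 'X))) => e e0.
split; first exact: entire_horner.
move=> z muz; rewrite ltr_normc; apply: normc_lt_of_sqr.
pose P : C -> C := fun z : C => (cpoly u v).[z].
have fE z0 : (cpoly u v + e%:C *: (cpoly u v * cpoly 0 (- 'X))).[z0] = P z0 * L e z0.
  rewrite hornerD hornerZ hornerM /L /P !horner_cpoly cev0 cevN cevX; ring.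
rewrite /fun_star !fE rmorphM /= -/(fun_star P z) !normcM !exprMn.
have /andP[L0 L1] := LE e z e0 muz.
have W : normc (fun_star P z) ^+ 2 <= normc (P z) ^+ 2.
  rewrite fun_star_cpoly /P horner_cpoly -subr_ge0 cpoly_normE mulr_ge0//.
  exact: uv.2.
have P0 : 0 < normc (P z) ^+ 2.
  rewrite exprn_gt0// normc_gt0; apply: contra_neq p0 => Pz.
  by apply: hb_pair_root uv muz _; rewrite -horner_cpoly.
nra.
Qed.

End ClassP.

(** * Pencils of real polynomials and constancy of sign *)

Section Pencils.
Variable R : realType.
Local Notation C := (R[i]^o).
Implicit Types (z : R[i]) (u v p q : {poly R}) (mu : R).

Lemma zfree_neq0 mu q : zfree mu q -> q != 0.
Proof.
move=> qf; have := qf (0 +i* (mu + 1)); rewrite ltrDl ltr01 => /(_ isT).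
by apply: contraNneq => ->; rewrite cev0.
Qed.

(** The zeros of a real polynomial are symmetric about the real axis, so the strip condition only
    concerns Im z > mu. *)
Lemma classSR0P mu q : 0 <= mu ->
  (classSR mu `|` [set 0]) q <-> q = 0 \/ zfree mu q.
Proof.
move=> mu0; split=> [[[q0 qS]|->]|[->|qf]]; [right|by left|by right|left].
  move=> z muz; apply/negP => /qS; apply/negP; rewrite -ltNge.
  exact: lt_le_trans muz (ler_norm _).
split; first by rewrite polyC_of_eq0; exact: zfree_neq0 qf.
move=> z qz; rewrite leNgt; apply/negP; rewrite ltr_normr => /orP[] muz.
  by have := qf z muz; rewrite /cev (eqP qz) eqxx.
have := qf (conjc z); rewrite cev_conj conjc_eq0 /cev (eqP qz) eqxx.
suff -> : mu < complex.Im (conjc z) by move/(_ isT).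
by case: (z) muz.
Qed.

Lemma wr_eq0_root u v z : wr u v z = 0 ->
  exists a b : R, (a != 0) || (b != 0) /\ cev (a *: u + b *: v) z = 0.
Proof.
rewrite /wr => W; have [v0|v0] := eqVneq (cev v z) 0.
  by exists 0, 1; rewrite oner_eq0 orbT scale0r add0r scale1r.
(* As u conj v is real at z, |v|^2 u = Re (u conj v) v there. *)
exists (normc (cev v z) ^+ 2), (- complex.Re (cev u z * conjc (cev v z))); split.
  by rewrite expf_eq0 /= (gt_eqF (_ : 0 < normc _)) ?normc_gt0.
move: W; rewrite cevD !cevZ normc_sqrE.
case: (cev u z) (cev v z) {v0} => [x1 y1] [x2 y2] /= W.
have {}W : x1 * y2 = y1 * x2 by lra.
apply/eqP; rewrite eq_complex /=; apply/andP; split; apply/eqP; ring: W.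
Qed.

Lemma continuous_cev p : continuous (fun x : C => cev p x : C).
Proof. exact: continuous_hornerC. Qed.

(** If the sign changed, [wr] would vanish at a point of the segment from z to z1, and so would a
    nontrivial real combination there; by the pencil condition it is the zero polynomial, so [wr] is
    0 everywhere, against its sign at z1. *)
Lemma pencil_hb_pair mu u v z : mu < complex.Im z -> pencil_zfree mu u v ->
  0 <= wr u v z -> hb_pair mu u v.
Proof.
move=> muz uv wz; split => // z1 muz1; rewrite leNgt; apply/negP => wz1.
pose g (s : R) : C := z + s%:C * (z1 - z).
have gc : continuous g.
  move=> s; apply: (@continuousD _ C); first exact: cst_continuous.
  by apply: (@continuousM R[i] R); [exact: continuous_real_complex|exact: cst_continuous].
have cc p : continuous (fun s => cev p (g s) : C).
  by move=> s; apply: continuous_comp; [exact: gc|exact: continuous_cev].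
have wc : {within `[0, 1], continuous (fun s => wr u v (g s))}.
  apply: continuous_subspaceT => s.
  have prodc : {for s, continuous (fun s => cev u (g s) * conjc (cev v (g s)) : C)}.
    apply: (@continuousM R[i] R); first exact: cc.
    by apply: (continuous_comp (cc v s)); exact: continuous_conjc.
  exact: (continuous_comp prodc (@continuous_Im _ _)).
have g0 : g 0 = z by rewrite /g mul0r addr0.
have g1 : g 1 = z1 by rewrite /g mul1r addrC subrK.
have [||s + ws] := IVT (v := 0) _ wc; first exact: ler01.
  by rewrite g0 g1 ge_min le_max wz (ltW wz1) orbT.
rewrite in_itv /= => /andP[s0 s1].
have gs : mu < complex.Im (g s).
  move: muz muz1; rewrite /g; case: (z) (z1) => [x y] [x1 y1] /= muy muy1.
  have [s_gt0|s_le0] := ltP 0 s; last first.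
    have -> : s = 0 by lra.
    lra.
  have : 0 < s * (y1 - mu) by rewrite mulr_gt0// subr_gt0.
  have : 0 <= (1 - s) * (y - mu) by rewrite mulr_ge0 ?subr_ge0// ltW.
  lra.
have [a [b [ab qs]]] := wr_eq0_root ws.
have [q0|/(_ _ gs)] := uv a b; last by rewrite qs eqxx.
have := @wr_root _ a b u v z1; rewrite q0 cev0 => /(_ erefl)[/eqP + /eqP].
rewrite !mulf_eq0 (lt_eqF wz1) !orbF => a0 b0.
by move: ab; rewrite a0 b0.
Qed.

Lemma wrC u v z : wr v u z = - wr u v z.
Proof. by rewrite /wr; case: (cev u z) (cev v z) => [? ?] [? ?] /=; ring. Qed.

Lemma wrN u v z : wr u (- v) z = - wr u v z.
Proof.
by rewrite /wr cevN; case: (cev u z) (cev v z) => [? ?] [? ?] /=; ring.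
Qed.

Lemma pencil_zfreeN mu u v : pencil_zfree mu u v -> pencil_zfree mu u (- v).
Proof. by move=> uv a b; rewrite scalerN -scaleNr; exact: uv. Qed.

Lemma pencil_hb_pairN mu u v z : mu < complex.Im z -> pencil_zfree mu u v ->
  wr u v z <= 0 -> hb_pair mu u (- v).
Proof.
move=> muz /pencil_zfreeN uv wz; apply: pencil_hb_pair muz uv _.
by rewrite wrN oppr_ge0.
Qed.

Lemma hb_pair0 mu u : u = 0 \/ zfree mu u -> hb_pair mu u 0.
Proof.
move=> uf; split=> [a b|z _]; last by rewrite /wr cev0 conjc0 mulr0.
rewrite scaler0 addr0; have [->|a0] := eqVneq a 0; first by left; rewrite scale0r.
case: uf => [->|uf]; [by left; rewrite scaler0|right => z /uf uz].
by rewrite cevZ mulf_neq0// eq_complex /= negb_and a0.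
Qed.

Lemma poly_star_cpoly u v : poly_star (cpoly u v) = cpoly u (- v).
Proof.
apply/polyP => i; rewrite coef_map coefD coefZ !coef_map coefD coefZ !coef_map /=.
by rewrite coefN; simpc.
Qed.

End Pencils.

(** * The operator on polynomials of any degree, and continuity of its values *)

Lemma continuous_sumC (R : realType) (X : topologicalType) (I : Type)
    (r : seq I) (F : I -> X -> R[i]^o) (t : X) :
  (forall i, {for t, continuous (F i)}) ->
  {for t, continuous (fun s => \sum_(i <- r) F i s)}.
Proof.
move=> Fc; have -> : (fun s => \sum_(i <- r) F i s) = \sum_(i <- r) F i.
  by apply/funext => s; rewrite fct_sumE.
elim: r => [|i r IH]; first by rewrite big_nil; exact: cst_continuous.
by rewrite big_cons; exact: continuousD (Fc i) IH.
Qed.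

Section Operator.
Variables (R : realType) (n : nat) (T : {linear {poly_n.+1 R} -> {poly R}}).
Local Notation C := (R[i]^o).
Implicit Types (z : R[i]) (u v p q : {poly R}) (mu : R).

(** Truncation extends T to all of [{poly R}], so that paths and products of polynomials carry no
    degree bound in their types. *)
Definition trunc_op p := T (npolyp n.+1 p).

Lemma trunc_opE (p : {poly_n.+1 R}) : trunc_op p = T p.
Proof. by congr (T _); apply: val_inj; rewrite /= npolypK ?size_npoly. Qed.

Lemma trunc_op_is_linear : linear trunc_op.
Proof.
move=> a p q; rewrite /trunc_op -linearP; congr (T _).
apply: val_inj; apply/polyP => i.
by rewrite /= coefD coefZ !coef_npolyp coefD coefZ; case: ifP; rewrite ?mulr0 ?addr0.
Qed.

HB.instance Definition _ :=
  GRing.isLinear.Build R {poly R} {poly R} *:%R trunc_op trunc_op_is_linear.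

Lemma trunc_opD p q : trunc_op (p + q) = trunc_op p + trunc_op q.
Proof. exact: linearD. Qed.

Lemma trunc_opZ (a : R) p : trunc_op (a *: p) = a *: trunc_op p.
Proof. exact: linearZ. Qed.

Lemma trunc_opB p q : trunc_op (p - q) = trunc_op p - trunc_op q.
Proof. exact: linearB. Qed.

Lemma trunc_op0 : trunc_op 0 = 0.
Proof. exact: linear0. Qed.

Lemma trunc_op_coef p : trunc_op p = \sum_(i < n.+1) p`_i *: trunc_op 'X^i.
Proof.
rewrite -[in RHS]/(\sum_(i < n.+1) p`_i *: trunc_op 'X^i).
have -> : trunc_op p = trunc_op (\poly_(i < n.+1) p`_i).
  by congr (T _); apply: val_inj; apply/polyP => i;
    rewrite /= !coef_npolyp coef_poly; case: ifP.
by rewrite poly_def linear_sum; apply: eq_bigr => i _; rewrite linearZ.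
Qed.

Lemma extend_cpoly u v (P : {poly_n.+1 R[i]}) :
  (size u <= n.+1)%N -> (size v <= n.+1)%N -> P = cpoly u v :> {poly R[i]} ->
  extend T P = cpoly (trunc_op u) (trunc_op v).
Proof.
move=> su sv PE.
by rewrite (@extendE _ _ _ (npolyp n.+1 u) (npolyp n.+1 v))// !npolypK.
Qed.

(** Only n + 1 coefficients enter the value, so coefficientwise continuity is enough. *)
Lemma continuous_trunc_op (U : R -> {poly R}) z (t : R) :
  (forall i, {for t, continuous (fun s => (U s)`_i)}) ->
  {for t, continuous (fun s => cev (trunc_op (U s)) z : C)}.
Proof.
move=> Uc; have -> : (fun s => cev (trunc_op (U s)) z : C) =
   (fun s => \sum_(i < n.+1) ((U s)`_i)%:C * cev (trunc_op 'X^i) z : C).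
  apply/funext => s; rewrite trunc_op_coef cev_sum.
  by apply: eq_bigr => i _; rewrite cevZ.
apply: (@continuous_sumC R R 'I_n.+1 (index_enum _)
  (fun i s => ((U s)`_i)%:C * cev (trunc_op 'X^i) z)) => i.
apply: (@continuousM R[i] R); last exact: cst_continuous.
exact: (continuous_comp (Uc i) (@continuous_real_complex _ _)).
Qed.

Lemma continuous_wr_trunc_op (U V : R -> {poly R}) z (t : R) :
  (forall i, {for t, continuous (fun s => (U s)`_i)}) ->
  (forall i, {for t, continuous (fun s => (V s)`_i)}) ->
  {for t, continuous (fun s => wr (trunc_op (U s)) (trunc_op (V s)) z)}.
Proof.
move=> Uc Vc.
have prodc : {for t, continuous (fun s =>
    cev (trunc_op (U s)) z * conjc (cev (trunc_op (V s)) z) : C)}.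
  apply: (@continuousM R[i] R); first exact: continuous_trunc_op.
  exact: (continuous_comp (continuous_trunc_op Vc) (@continuous_conjc _ _)).
exact: (continuous_comp prodc (@continuous_Im _ _)).
Qed.

End Operator.
(** * Interior pairs and paths *)

Section Interior.
Variable R : realType.
Implicit Types (z w : R[i]) (u v p q r : {poly R}) (mu : R) (m : nat).

(** The natural size of [wr]: for degrees at most m + 1 it is Im z times a polynomial of degree at
    most 2 m in Re z and Im z. *)
Definition weight m z : R := complex.Im z * (1 + normc z ^+ 2) ^+ m.

(* For u, v of degree at most m + 1, |wr u v z| is at most a multiple of
   [weight m z] ([wr_boundedP]), so this is an open condition on (u, v). *)
Definition interior mu m u v := exists2 c : R, 0 < c &
  forall z, mu < complex.Im z -> c * weight m z <= wr u v z.

Lemma weight_gt0 m z : 0 < complex.Im z -> 0 < weight m z.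
Proof. by move=> z0; rewrite mulr_gt0 ?exprn_gt0// ltr_pwDl// sqr_ge0. Qed.

Lemma interior_gt0 mu m u v z : 0 <= mu -> interior mu m u v ->
  mu < complex.Im z -> 0 < wr u v z.
Proof.
move=> mu0 [c c0 H] muz; apply: lt_le_trans (H z muz).
by rewrite mulr_gt0// weight_gt0// (le_lt_trans mu0).
Qed.

Definition wr_bounded m u v := exists C : R,
  forall z, 0 < complex.Im z -> `|wr u v z| <= C * weight m z.

Lemma wr_boundedC m u v : wr_bounded m u v -> wr_bounded m v u.
Proof. by move=> [C H]; exists C => z z0; rewrite wrC normrN H. Qed.

Lemma wrDl u p v z : wr (u + p) v z = wr u v z + wr p v z.
Proof. by rewrite /wr cevD mulrDl raddfD. Qed.

Lemma wrZl (a : R) u v z : wr (a *: u) v z = a * wr u v z.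
Proof.
by rewrite /wr cevZ; case: (cev u z) (cev v z) => [? ?] [? ?] /=; ring.
Qed.

Lemma wr_bounded_sum m (I : Type) (s : seq I) (F : I -> {poly R}) v :
  (forall i, wr_bounded m (F i) v) -> wr_bounded m (\sum_(i <- s) F i) v.
Proof.
move=> Fv; elim: s => [|i s [C IH]].
  by exists 0 => z _; rewrite big_nil /wr cev0 mul0r normr0 mul0r.
have [D FD] := Fv i; exists (D + C) => z z0.
by rewrite big_cons wrDl mulrDl (le_trans (ler_normD _ _))// lerD// ?FD// IH.
Qed.

Lemma wr_boundedZ m (a : R) u v : wr_bounded m u v -> wr_bounded m (a *: u) v.
Proof.
move=> [C H]; exists (`|a| * C) => z z0.
by rewrite wrZl normrM -mulrA ler_wpM2l// H.
Qed.

Lemma Im_expr_bound (s : R) k z : 0 < complex.Im z -> normc z <= s ->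
  `|complex.Im (z ^+ k.+1)| <= k.+1%:R * (complex.Im z * s ^+ k).
Proof.
move=> z0 zs; have s0 : 0 <= s by exact: le_trans (normc_ge0 z) zs.
elim: k => [|k IH]; first by rewrite expr1 expr0 mulr1 mul1r gtr0_norm.
have -> : complex.Im (z ^+ k.+2) = complex.Im z * complex.Re (z ^+ k.+1) +
   complex.Re z * complex.Im (z ^+ k.+1).
  by rewrite exprS; case: z {zs z0 IH} (z ^+ k.+1) => [? ?] [? ?] /=; ring.
rewrite (le_trans (ler_normD _ _))// !normrM (gtr0_norm z0).
have H1 : `|complex.Re (z ^+ k.+1)| <= s ^+ k.+1.
  by rewrite (le_trans (Re_le_normc _))// normcX lerXn2r ?nnegrE ?normc_ge0.
have H2 : `|complex.Re z| * `|complex.Im (z ^+ k.+1)| <=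
    s * (k.+1%:R * (complex.Im z * s ^+ k)).
  by rewrite ler_pM// (le_trans (Re_le_normc _)).
move: H1 H2; set A := z ^+ k.+1 => H1 H2.
have := ler_wpM2l (ltW z0) H1; rewrite -[k.+2%:R]natr1 [s ^+ k.+1]exprS; lra.
Qed.

(** For j < i, z^i conj z^j = |z|^(2j) z^(i-j), and [Im_expr_bound] applies to the last factor with
    s^2 = 1 + |z|^2. *)
Lemma wr_bounded_monom m i j : (i <= m.+1)%N -> (j <= m.+1)%N ->
  wr_bounded m ('X^i : {poly R}) 'X^j.
Proof.
wlog : i j / (j <= i)%N => [H im jm|].
  have /orP[ij|ij] := leq_total i j; last exact: H.
  by apply: wr_boundedC; exact: H.
rewrite leq_eqVlt => /predU1P[->|ji] im _.
  exists 0 => z _; rewrite /wr mul0r.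
  by case: (cev _ z) => a b /=; rewrite mulrN mulrC addNr normr0.
exists (i - j)%:R => z z0.
have cevXn k : cev 'X^k z = z ^+ k by rewrite /cev /polyC_of map_polyXn hornerXn.
pose s := Num.sqrt (1 + normc z ^+ 2).
have s2 : s ^+ 2 = 1 + normc z ^+ 2 by rewrite sqr_sqrtr// addr_ge0// sqr_ge0.
have s1 : 1 <= s.
  by rewrite -[1]sqrtr1 ler_sqrt// ?lerDl ?sqr_ge0// addr_ge0// sqr_ge0.
have zs : normc z <= s.
  rewrite -(ler_pXn2r (_ : (0 < 2)%N)) ?nnegrE ?normc_ge0 ?(le_trans ler01)//.
  by rewrite s2 lerDr.
rewrite /wr !cevXn.
have -> : z ^+ i * conjc (z ^+ j) = ((normc z ^+ 2) ^+ j)%:C * z ^+ (i - j).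
  rewrite -{1}(subnK (ltnW ji)) exprD -mulrA exprAC -normcX mulrC.
  congr (_ * _); rewrite normc_sqrE; case: (z ^+ j) => a b; simpc.
  by congr (_ +i* _); ring.
have -> (a : R) w : complex.Im (a%:C * w) = a * complex.Im w.
  by case: w => ? ? /=; ring.
have {1}-> : (i - j = (i - j).-1.+1)%N by rewrite prednK// subn_gt0.
rewrite normrM ger0_norm; last by rewrite exprn_ge0// sqr_ge0.
have B := Im_expr_bound (i - j).-1 z0 zs.
have Nj : (normc z ^+ 2) ^+ j <= s ^+ (2 * j).
  by rewrite exprM lerXn2r ?nnegrE ?sqr_ge0// s2 lerDr.
rewrite (le_trans (ler_pM _ _ Nj B))// ?exprn_ge0 ?normc_ge0//.
rewrite prednK ?subn_gt0// mulrCA ler_wpM2l//.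
rewrite /weight -s2 -exprM mulrCA -exprD; apply: ler_wpM2l; first exact: ltW.
(* The exponent i + j - 1 is at most 2 m since j < i <= m + 1. *)
by apply: ler_weXn2l => //; lia.
Qed.

Lemma wr_boundedP m u v : (size u <= m.+2)%N -> (size v <= m.+2)%N ->
  wr_bounded m u v.
Proof.
move=> su sv.
have E p : (size p <= m.+2)%N -> p = \sum_(i < m.+2) p`_i *: 'X^i.
  by move=> sp; rewrite -poly_def; apply/polyP => i; rewrite coef_poly;
    case: ltnP => // im; rewrite nth_default// (leq_trans sp).
rewrite (E _ su) (E _ sv); apply: wr_bounded_sum => i; apply: wr_boundedZ.
apply: wr_boundedC; apply: wr_bounded_sum => j; apply: wr_boundedZ.
by apply: wr_bounded_monom; rewrite -ltnS.
Qed.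

(** The new pair is (a + ib)(u + iv), and [wr] is a quarter of |p|^2 - |p^*|^2. *)
Lemma wr_rot (a b : R) u v z :
  wr (a *: u - b *: v) (b *: u + a *: v) z = (a ^+ 2 + b ^+ 2) * wr u v z.
Proof.
rewrite /wr -scaleNr !cevD !cevZ.
by case: (cev u z) (cev v z) => [? ?] [? ?] /=; ring.
Qed.

(** With e (1 + |C|) = c, [wr (u + e *: r) v] is at least e times the weight, hence positive, and u
    + e r cannot vanish. *)
Lemma interior_perturb mu m u v r : 0 <= mu -> interior mu m u v ->
  (size v <= m.+2)%N -> (size r <= m.+2)%N ->
  exists2 e : R, 0 < e & zfree mu (u + e *: r).
Proof.
move=> mu0 [c c0 uv] sv sr; have [C rC] := wr_boundedP sr sv.
have C1 : 0 < 1 + `|C| by have := normr_ge0 C; lra.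
exists (c / (1 + `|C|)); first by rewrite divr_gt0.
move=> z muz; set e := c / _; have e0 : 0 < e by rewrite divr_gt0.
have w0 : 0 < weight m z by rewrite weight_gt0// (le_lt_trans mu0).
have : 0 < wr (u + e *: r) v z.
  have H : `|wr r v z| <= `|C| * weight m z.
    rewrite (le_trans (rC z (le_lt_trans mu0 muz)))//.
    by rewrite ler_wpM2r ?ler_norm// ltW.
  have {}H : - (`|C| * weight m z) <= wr r v z.
    by rewrite lerNl (le_trans _ H)// -normrN ler_norm.
  have eC : c * weight m z = e * weight m z + e * (`|C| * weight m z).
    by rewrite /e; field; rewrite gt_eqF.
  have := uv z muz; rewrite eC wrDl wrZl.
  have := ler_wpM2l (ltW e0) H; have : 0 < e * weight m z by rewrite mulr_gt0.
  lra.
by apply: contraTneq => qz; rewrite /wr qz mul0r ltxx.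
Qed.

End Interior.

(** * Products of linear factors: lower bounds and logarithmic derivatives *)

Section Products.
Variable R : realType.
Implicit Types (z w : R[i]) (u v p q r : {poly R}) (mu : R) (m : nat).

Definition rootprod (s : seq R[i]) : {poly R[i]} := \prod_(w <- s) ('X - w%:P).

Lemma rootprod_cons w s : rootprod (w :: s) = ('X - w%:P) * rootprod s.
Proof. by rewrite /rootprod big_cons. Qed.

(** With d = mu - Im w one has d <= |z - w| and 1 + |z|^2 <= A + 2 |z - w|^2, where A <= (A / d^2)
    |z - w|^2. *)
Lemma dist_lower_bound mu w : complex.Im w < mu -> exists2 c : R, 0 < c &
  forall z, mu < complex.Im z -> c * (1 + normc z ^+ 2) <= normc (z - w) ^+ 2.
Proof.
move=> wmu; set d := mu - complex.Im w; have d0 : 0 < d by rewrite subr_gt0.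
set A := 1 + 2 * normc w ^+ 2; have A0 : 0 < A by rewrite /A; have := sqr_ge0 (normc w); lra.
have B0 : 0 < 2 + A / d ^+ 2 by rewrite addr_gt0// divr_gt0// exprn_gt0.
exists (2 + A / d ^+ 2)^-1; first by rewrite invr_gt0.
move=> z muz; rewrite mulrC ler_pdivrMr// mulrDr.
have dz : d ^+ 2 <= normc (z - w) ^+ 2.
  rewrite normc_sqrE; have -> : complex.Im (z - w) = complex.Im z - complex.Im w.
    by case: (z) (w) => [? ?] [? ?].
  rewrite /d in d0 *; have := sqr_ge0 (complex.Re (z - w)); nra.
have : A <= normc (z - w) ^+ 2 * (A / d ^+ 2).
  by rewrite mulrCA ler_peMr ?(ltW A0)// ler_pdivlMr ?exprn_gt0// mul1r.
have : normc z ^+ 2 <= 2 * normc (z - w) ^+ 2 + 2 * normc w ^+ 2.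
  rewrite !normc_sqrE; case: (z) (w) => [a b] [e f] /=.
  have := sqr_ge0 (a - 2 * e); have := sqr_ge0 (b - 2 * f); lra.
rewrite /A; lra.
Qed.

Lemma rootprod_lower_bound mu (s : seq R[i]) :
  (forall w, w \in s -> complex.Im w < mu) -> exists2 c : R, 0 < c &
  forall z, mu < complex.Im z ->
    c * (1 + normc z ^+ 2) ^+ size s <= normc (rootprod s).[z] ^+ 2.
Proof.
elim: s => [|w s IH] H.
  by exists 1 => // z _; rewrite /rootprod big_nil hornerC normc1 expr1n expr0 mulr1.
have [c c0 cP] := dist_lower_bound (H w (mem_head _ _)).
have [|d d0 dP] := IH; first by move=> x xs; apply: H; rewrite inE xs orbT.
exists (c * d) => [|z muz]; first exact: mulr_gt0.
rewrite rootprod_cons hornerM hornerXsubC normcM exprMn /=.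
have N0 : 0 < 1 + normc z ^+ 2 by rewrite ltr_pwDl// sqr_ge0.
rewrite [_ ^+ (size s).+1]exprS mulrACA; apply: ler_pM; rewrite ?cP ?dP//.
  by rewrite mulr_ge0 ?ltW.
by rewrite mulr_ge0 ?exprn_ge0// ltW.
Qed.

(** The logarithmic derivative of the product is 1 / (z - w) + g' / g; multiplying by |z - w|^2
    |g|^2 gives a form valid at the zeros too. *)
Lemma Im_deriv_XsubC (g : {poly R[i]}) w z :
  complex.Im ((('X - w%:P) * g)^`().[z] * conjc (('X - w%:P) * g).[z]) =
  normc (z - w) ^+ 2 * complex.Im (g^`().[z] * conjc g.[z]) -
  (complex.Im z - complex.Im w) * normc g.[z] ^+ 2.
Proof.
rewrite derivM derivXsubC mul1r hornerD !hornerM hornerXsubC !normc_sqrE.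
by case: (z) (w) g.[z] g^`().[z] => [? ?] [? ?] [? ?] [? ?] /=; ring.
Qed.

(** At a height not below the zeros w, each summand 1 / (z - w) of the logarithmic derivative has
    imaginary part at most 0. *)
Lemma Im_deriv_rootprod_le0 (s : seq R[i]) z :
  (forall w, w \in s -> complex.Im w <= complex.Im z) ->
  complex.Im ((rootprod s)^`().[z] * conjc (rootprod s).[z]) <= 0.
Proof.
elim: s => [|w s IH] H.
  by rewrite /rootprod big_nil derivC horner0 mul0r.
rewrite rootprod_cons Im_deriv_XsubC subr_le0 (@le_trans _ _ 0)//.
  rewrite mulr_ge0_le0 ?sqr_ge0//; apply: IH => x xs; apply: H.
  by rewrite inE xs orbT.
by rewrite mulr_ge0 ?sqr_ge0// subr_ge0 H// mem_head.
Qed.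

Lemma Im_deriv_rootprod_lt w (s : seq R[i]) z :
  (forall w, w \in s -> complex.Im w <= complex.Im z) ->
  complex.Im ((rootprod (w :: s))^`().[z] * conjc (rootprod (w :: s)).[z]) <=
  - ((complex.Im z - complex.Im w) * normc (rootprod s).[z] ^+ 2).
Proof.
move=> H; rewrite rootprod_cons Im_deriv_XsubC gerDr.
by rewrite mulr_ge0_le0 ?sqr_ge0// Im_deriv_rootprod_le0.
Qed.

(** A point of the upper half-plane is at least as close to conj w as to w when Im w <= 0. *)
Lemma rootprod_conj_le (s : seq R[i]) z : 0 < complex.Im z ->
  (forall w, w \in s -> complex.Im w <= 0) ->
  normc (rootprod (map (@conjc R) s)).[z] ^+ 2 <= normc (rootprod s).[z] ^+ 2.
Proof.
move=> z0; elim: s => [|w s IH] H; first by [].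
rewrite map_cons !rootprod_cons !hornerM !hornerXsubC !normcM !exprMn.
apply: ler_pM; rewrite ?sqr_ge0//; last first.
  by apply: IH => x xs; apply: H; rewrite inE xs orbT.
have := H w (mem_head _ _); rewrite !normc_sqrE.
case: (z) (w) z0 => [? ?] [? ?] /=; nra.
Qed.

(** The identity |z - w|^2 = |z - conj w|^2 - 4 Im z Im w gives the gain for the first factor;
    [rootprod_conj_le] handles the others. *)
Lemma rootprod_conj_lt w (s : seq R[i]) z : 0 < complex.Im z ->
  (forall x, x \in w :: s -> complex.Im x <= 0) ->
  - 4 * complex.Im z * complex.Im w * normc (rootprod s).[z] ^+ 2 <=
  normc (rootprod (w :: s)).[z] ^+ 2 -
  normc (rootprod (map (@conjc R) (w :: s))).[z] ^+ 2.
Proof.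
move=> z0 H; have sH : forall x, x \in s -> complex.Im x <= 0.
  by move=> x xs; apply: H; rewrite inE xs orbT.
have := rootprod_conj_le z0 sH.
rewrite map_cons !rootprod_cons !hornerM !hornerXsubC !normcM !exprMn.
set A := normc (rootprod s).[z] ^+ 2.
set B := normc (rootprod (map _ s)).[z] ^+ 2 => BA.
have : normc (z - conjc w) ^+ 2 * B <= normc (z - conjc w) ^+ 2 * A.
  by rewrite ler_wpM2l// sqr_ge0.
suff -> : normc (z - w) ^+ 2 = normc (z - conjc w) ^+ 2 - 4 * complex.Im z * complex.Im w.
  lra.
by rewrite !normc_sqrE; case: (z) (w) => [? ?] [? ?] /=; ring.
Qed.

Lemma cev_deriv p z : cev p^`() z = (polyC_of p)^`().[z].
Proof. by rewrite /cev /polyC_of deriv_map. Qed.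

Lemma cev_coef_wide k p z : (size p <= k)%N ->
  cev p z = \sum_(i < k) (p`_i)%:C * z ^+ i.
Proof.
move=> pk; rewrite /cev (@horner_coef_wide _ k) ?size_map_poly//.
by apply: eq_bigr => i _; rewrite coef_map.
Qed.

End Products.

(** * Paths of interior pairs to a common endpoint *)

Section Paths.
Variable R : realType.
Local Notation C := (R[i]^o).
Implicit Types (z w : R[i]) (u v p q r : {poly R}) (mu : R) (m : nat).

(** The path starts at (a + ib)(u + iv), which by [wr_rot] does not affect the sign of [wr] and
    leaves room to normalise the leading coefficient. The time 0 is left out of the interior
    condition since u + iv may be a boundary point. *)
Definition interior_path mu m u v E F := exists (U V : R -> {poly R}) (a b : R),
  [/\ (a != 0) || (b != 0), U 0 = a *: u - b *: v & V 0 = b *: u + a *: v] /\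
  [/\ U 1 = E, V 1 = F,
     forall t i, {for t, continuous (fun s => (U s)`_i)},
     forall t i, {for t, continuous (fun s => (V s)`_i)} &
     forall t, 0 < t <= 1 -> [/\ (size (U t) <= m.+2)%N, (size (V t) <= m.+2)%N &
       interior mu m (U t) (V t)]].

(* t^(m+1) p(z / t), which still makes sense at t = 0. *)
Definition hscale m (t : R) p : {poly R} := \poly_(k < m.+2) (p`_k * t ^+ (m.+1 - k)).

Lemma cev_hscale m t p z : (size p <= m.+2)%N -> t != 0 ->
  cev (hscale m t p) z = (t ^+ m.+1)%:C * cev p (t^-1%:C * z).
Proof.
move=> sp t0; rewrite (cev_coef_wide z (size_poly _ _)) (cev_coef_wide _ sp).
rewrite big_distrr; apply: eq_bigr => i _ /=.
rewrite coef_poly ltn_ord exprMn mulrCA !mulrA -rmorphXn -!rmorphM /=.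
have im : (i <= m.+1)%N by rewrite -ltnS.
have -> : t ^+ (m.+1 - i) = t ^+ m.+1 * t^-1 ^+ i.
  by rewrite -[X in t ^+ X * _](subnK im) exprD -mulrA -exprMn divff// expr1n mulr1.
by congr (_%:C * _); ring.
Qed.

Lemma hscale0 m p : hscale m 0 p = p`_m.+1 *: 'X^(m.+1).
Proof.
apply/polyP => i; rewrite coef_poly coefZ coefXn.
case: ltnP => im; last by rewrite gtn_eqF// mulr0.
rewrite expr0n subn_eq0; have -> : (m < i)%N = (i == m.+1) by lia.
by case: eqP => [->|]; rewrite ?mulr0.
Qed.

Lemma hscale1 m p : (size p <= m.+2)%N -> hscale m 1 p = p.
Proof.
move=> sp; apply/polyP => i; rewrite coef_poly expr1n mulr1.
by case: ltnP => // im; rewrite nth_default// (leq_trans sp).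
Qed.

Lemma polyC_of_rootprod p : p \is monic ->
  exists2 s, polyC_of p = rootprod s & size s = (size p).-1.
Proof.
move=> pm; have [s sE] := closed_field_poly_normal (polyC_of p).
have lp : lead_coef (polyC_of p) = 1 by rewrite lead_coef_map (monicP pm) rmorph1.
rewrite lp scale1r in sE; exists s => //.
by rewrite -(size_map_poly (real_complex R)) -/(polyC_of p) sE size_prod_XsubC.
Qed.

(* Im ((u - t v') conj v) = Im (u conj v) - t |v|^2 Im (v' / v), and -Im (v' / v)
   is positive above the zeros of v, which the scaling moved strictly inside the
   strip. *)
Lemma hscale_interior mu m u v (t : R) : 0 < mu -> hb_pair mu u v ->
  (size u <= m.+2)%N -> (size v <= m.+2)%N -> v`_m.+1 = 1 -> 0 < t <= 1 ->
  interior mu m (hscale m (1 - t) u - t *: (hscale m (1 - t) v)^`())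
    (hscale m (1 - t) v).
Proof.
move=> mu0 [uv wr0] su sv v1 /andP[t0 t1].
set s := 1 - t; have s0 : 0 <= s by rewrite subr_ge0.
have s1 : s < 1 by rewrite ltrBlDr ltrDl.
set U := hscale m s u; set V := hscale m s v.
have Vc : V`_m.+1 = 1 by rewrite coef_poly ltnSn subnn expr0 mulr1.
have sV : size V = m.+2.
  apply/eqP; rewrite eqn_leq size_poly /= ltnNge; apply/negP => sV.
  by move: Vc => /eqP; rewrite nth_default// eq_sym oner_eq0.
have Vm : V \is monic by rewrite monicE lead_coefE sV /= Vc.
have [ws VE sws] := polyC_of_rootprod Vm; rewrite sV /= in sws.
have zscale z : s != 0 -> mu < complex.Im z -> mu < complex.Im (s^-1%:C * z).
  move=> sn muz; have sp : 0 < s by rewrite lt_neqAle eq_sym sn.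
  have -> : complex.Im (s^-1%:C * z) = complex.Im z / s.
    by case: (z) => a b /=; rewrite mul0r addr0 mulrC.
  by rewrite ltr_pdivlMr// (le_lt_trans _ muz)// ler_piMr ?ltW.
have vf : zfree mu v.
  by have := uv 0 1; rewrite scale0r add0r scale1r => -[v0|//];
    move: v1 => /eqP; rewrite v0 coef0 eq_sym oner_eq0.
(* For s nonzero the pair is evaluated at z / s, still above mu; for s = 0 both polynomials are
   multiples of X^(m+1) and [wr] is 0. *)
have UV0 z : mu < complex.Im z -> 0 <= wr U V z.
  move=> muz; have [se|sn] := eqVneq s 0.
    rewrite /U /V se !hscale0 v1 scale1r wrZl /wr.
    by case: (cev 'X^(m.+1) z) => a b /=; rewrite mulrN [b * a]mulrC addNr mulr0.
  rewrite /wr !cev_hscale//.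
  have := wr0 _ (zscale z sn muz); rewrite /wr.
  have : 0 <= s ^+ m.+1 by rewrite exprn_ge0.
  move: (s ^+ m.+1) => x; case: (cev u _) (cev v _) => [a b] [c d] /= x0 W.
  have := mulr_ge0 (mulr_ge0 x0 x0) W; lra.
(* The zeros of V are s times those of v, whose height is at most mu. *)
have wsmu w : w \in ws -> complex.Im w <= s * mu.
  move=> wws; have Vw : cev V w = 0.
    by apply/eqP; rewrite /cev VE -/(root _ w) root_prod_XsubC.
  rewrite leNgt; apply/negP => smu.
  have [se|sn] := eqVneq s 0.
    move: Vw; rewrite /V se hscale0 v1 scale1r /cev /polyC_of map_polyXn hornerXn.
    move/eqP; rewrite expf_eq0 /= => /eqP w0.
    by move: smu; rewrite w0 se mul0r ltxx.
  have sp : 0 < s by rewrite lt_neqAle eq_sym sn.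
  move: Vw; rewrite /V cev_hscale// => /eqP; rewrite mulf_eq0.
  rewrite (_ : (_%:C == 0) = false) /=; last first.
    by rewrite (fmorph_eq0 (real_complex R)) expf_eq0 (negbTE sn).
  apply/negP; apply: vf.
  have -> : complex.Im (s^-1%:C * w) = complex.Im w / s.
    by case: (w) => a b /=; rewrite mul0r addr0 mulrC.
  by rewrite ltr_pdivlMr// mulrC.
(* One zero w is set apart for the logarithmic derivative; the other m give the weight. *)
case: ws VE sws wsmu => // w ws VE [sws] wsmu.
have smu : s * mu < mu by rewrite gtr_pMl.
have [|c c0 cP] := @rootprod_lower_bound R mu ws.
  by move=> x xs; rewrite (le_lt_trans _ smu)// wsmu// inE xs orbT.
(* One t is the coefficient of the derivative, the other comes from Im z - Im w >= t Im z. *)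
exists (t * t * c); first by rewrite !mulr_gt0.
move=> z muz; have z0 : 0 < complex.Im z by exact: lt_trans muz.
have Iw : forall x, x \in ws -> complex.Im x <= complex.Im z.
  move=> x xs; rewrite (le_trans (wsmu _ _)) ?inE ?xs ?orbT//.
  by rewrite ltW// (lt_trans smu).
have := Im_deriv_rootprod_lt w Iw; rewrite -VE -cev_deriv -/(cev V z) -/(wr _ _ z).
have := cP z muz; rewrite sws /weight.
set B := normc (rootprod ws).[z] ^+ 2; set N := (1 + _) ^+ m => cB dV.
rewrite -scaleNr wrDl wrZl mulNr.
have := UV0 z muz; set W := wr U V z; set D := wr _ _ z in dV * => W0.
have zw : t * complex.Im z <= complex.Im z - complex.Im w.
  have := wsmu w (mem_head _ _); rewrite /s; have := ler_wpM2l s0 (ltW muz).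
  rewrite /s; lra.
have B0 : 0 <= B by exact: sqr_ge0.
have H1 := ler_wpM2r B0 zw.
have H2 : t * (t * complex.Im z * (c * N)) <= t * (t * complex.Im z * B).
  by do 2 (apply: ler_wpM2l; first by rewrite ?mulr_ge0 ?(ltW t0) ?(ltW z0)).
have H3 := ler_wpM2l (ltW t0) H1.
have H4 := ler_wpM2l (ltW t0) dV.
lra.
Qed.

Lemma continuous_subr1 : continuous (fun s : R => 1 - s).
Proof. by move=> t; apply: continuousB; [exact: cst_continuous|]. Qed.

Lemma continuous_expr (f : R -> R) k t : {for t, continuous f} ->
  {for t, continuous (fun s => f s ^+ k)}.
Proof. by move=> fc; exact: (continuous_comp fc (@exprn_continuous _ k _)). Qed.

Lemma continuous_hscale m p i (t : R) :
  {for t, continuous (fun s : R => (hscale m (1 - s) p)`_i)}.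
Proof.
have -> : (fun s => (hscale m (1 - s) p)`_i) =
    (fun s => (if (i < m.+2)%N then p`_i else 0) * (1 - s) ^+ (m.+1 - i)).
  by apply/funext => s; rewrite coef_poly; case: ifP => //; rewrite mul0r.
apply: continuousM; first exact: cst_continuous.
exact/continuous_expr/continuous_subr1.
Qed.

Lemma hb_pair_rot (a b : R) mu u v : hb_pair mu u v ->
  hb_pair mu (a *: u - b *: v) (b *: u + a *: v).
Proof.
move=> [uv wr0]; split => [c d|z muz].
  have -> : c *: (a *: u - b *: v) + d *: (b *: u + a *: v) =
      (c * a + d * b) *: u + (d * a - c * b) *: v.
    rewrite scalerBr scalerDr !scalerA scalerDl scalerBl.
    rewrite [_ *: v - _]addrC !addrA; congr (_ + _).
    by rewrite -!addrA; congr (_ + _); rewrite addrC.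
  exact: uv.
by rewrite wr_rot mulr_ge0 ?wr0// addr_ge0// sqr_ge0.
Qed.

Lemma size_lin2 (a b : R) p q k : (size p <= k)%N -> (size q <= k)%N ->
  (size (a *: p + b *: q)%R <= k)%N.
Proof.
move=> pk qk; rewrite (leq_trans (size_polyD _ _))// geq_max.
by rewrite !(leq_trans (size_scale_leq _ _)).
Qed.

(** After a rotation u has degree at most m and v is monic of degree m + 1. The path of
    [hscale_interior] then contracts u to 0 and v to X^(m+1), so its end does not depend on the
    pair. *)
Lemma interior_path_strip mu m u v : 0 < mu -> hb_pair mu u v ->
  (size u <= m.+2)%N -> (size v <= m.+2)%N ->
  (u`_m.+1 != 0) || (v`_m.+1 != 0) ->
  interior_path mu m u v (- ('X^(m.+1))^`()) 'X^(m.+1).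
Proof.
move=> mu0 uv su sv uv0; set x := u`_m.+1 in uv0; set y := v`_m.+1 in uv0.
have D0 : x ^+ 2 + y ^+ 2 != 0.
  by rewrite paddr_eq0 ?sqr_ge0// !expf_eq0 /= negb_and.
(* Chosen so that (a + ib)(x + iy) = i. *)
set D := x ^+ 2 + y ^+ 2 in D0; pose a := y / D; pose b := x / D.
set u1 := a *: u - b *: v; set v1 := b *: u + a *: v.
have u1E : u1`_m.+1 = 0 by rewrite coefB !coefZ -/x -/y /a /b; field.
have v1E : v1`_m.+1 = 1 by rewrite coefD !coefZ -/x -/y /a /b /D; field.
have su1 : (size u1 <= m.+2)%N by rewrite /u1 -scaleNr size_lin2.
have sv1 : (size v1 <= m.+2)%N by rewrite size_lin2.
have hb1 : hb_pair mu u1 v1 by exact: hb_pair_rot.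
exists (fun t => hscale m (1 - t) u1 - t *: (hscale m (1 - t) v1)^`()),
  (fun t => hscale m (1 - t) v1), a, b; split; split => //.
- by rewrite /a /b !mulf_eq0 invr_eq0 (negbTE D0) !orbF orbC.
- by rewrite subr0 hscale1// scale0r subr0.
- by rewrite subr0 hscale1.
- by rewrite subrr !hscale0 u1E v1E scale0r !scale1r sub0r.
- by rewrite subrr hscale0 v1E scale1r.
- move=> t i.
  have -> : (fun s => (hscale m (1 - s) u1 - s *: (hscale m (1 - s) v1)^`())`_i) =
    (fun s => (hscale m (1 - s) u1)`_i) -
    (fun s => s) * (fun s => (hscale m (1 - s) v1)`_i.+1 *+ i.+1).
    by apply/funext => s; rewrite coefB coefZ coef_deriv.
  apply: continuousB; first exact: continuous_hscale.
  apply: continuousM => //.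
  have -> : (fun s => (hscale m (1 - s) v1)`_i.+1 *+ i.+1) =
    (fun s => i.+1%:R * (hscale m (1 - s) v1)`_i.+1).
    by apply/funext => s; rewrite mulr_natl.
  apply: continuousM; first exact: cst_continuous.
  exact: continuous_hscale.
- by move=> t i; exact: continuous_hscale.
- move=> t t01; split; last exact: hscale_interior.
    rewrite -scaleNr -[hscale _ _ u1]scale1r size_lin2 ?size_poly//.
    set q := hscale _ _ v1; have [->|q0] := eqVneq q 0.
      by rewrite deriv0 size_poly0.
    by rewrite (leq_trans (ltnW (lt_size_deriv q0)))// size_poly.
  exact: size_poly.
Qed.

Lemma map_ReK u v : map_poly (@complex.Re R) (cpoly u v) = u.
Proof.
apply/polyP => i; rewrite coef_map_id0// coefD coefZ !coef_map /=.
by rewrite mul0r mul1r subr0 addr0.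
Qed.

Lemma map_ImK u v : map_poly (@complex.Im R) (cpoly u v) = v.
Proof.
apply/polyP => i; rewrite coef_map_id0// coefD coefZ !coef_map /=.
by rewrite mul0r mul1r !add0r.
Qed.

Lemma cpoly_ReIm (P : {poly R[i]}) :
  cpoly (map_poly (@complex.Re R) P) (map_poly (@complex.Im R) P) = P.
Proof.
apply/polyP => i; rewrite coefD coefZ !coef_map.
by rewrite -complexE.
Qed.

Lemma cpoly_rot (a b : R) u v :
  cpoly (a *: u - b *: v) (b *: u + a *: v) = (a +i* b) *: cpoly u v.
Proof.
apply/polyP => i; rewrite coefZ !coefD !coefZ !coef_map !coefD coefN !coefZ /=.
by simpc; congr (_ +i* _); ring.
Qed.

Lemma wr_map_poly (P : {poly R[i]}) z :
  4 * wr (map_poly (@complex.Re R) P) (map_poly (@complex.Im R) P) z =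
  normc P.[z] ^+ 2 - normc (poly_star P).[z] ^+ 2.
Proof.
rewrite -{3 4}(cpoly_ReIm P) poly_star_cpoly !horner_cpoly cevN mulrN.
by rewrite cpoly_normE.
Qed.

Lemma poly_star_rootprod (s : seq R[i]) :
  poly_star (rootprod s) = rootprod (map (@conjc R) s).
Proof.
rewrite /poly_star /rootprod rmorph_prod big_map; apply: eq_bigr => w _.
by rewrite rmorphB /= map_polyX map_polyC.
Qed.

Lemma continuous_rootprod_coef (f : R -> R[i] -> R[i]) (s : seq R[i]) :
  (forall w t, {for t, continuous (fun t => f t w : C)}) ->
  forall i t, {for t, continuous (fun t => (rootprod (map (f t) s))`_i : C)}.
Proof.
move=> fc; elim: s => [|w s IH] i t.
  have -> : (fun t => (rootprod (map (f t) [::]))`_i : C) =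
    cst ((rootprod [::])`_i) by [].
  exact: cst_continuous.
have shift_c : {for t, continuous (fun t =>
   (if i is j.+1 then (rootprod (map (f t) s))`_j else 0) : C)}.
  by case: i => [|j]; [exact: cst_continuous|exact: IH].
have prod_c : {for t, continuous (fun t => f t w * (rootprod (map (f t) s))`_i : C)}.
  by apply: (@continuousM R[i] R); [exact: fc|exact: IH].
have -> : (fun t => (rootprod (map (f t) (w :: s)))`_i : C) =
  (fun t => (if i is j.+1 then (rootprod (map (f t) s))`_j else 0) -
    f t w * (rootprod (map (f t) s))`_i : C).
  apply/funext => x; rewrite map_cons rootprod_cons mulrBl coefB coefCM coefXM.
  by case: (i).
exact: (continuousB shift_c prod_c).
Qed.

(** The zero w contributes - 4 Im z Im w >= 4 h Im z by [rootprod_conj_lt], the others the power of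
    1 + |z|^2; the factor 4 is that of [wr_map_poly]. *)
Lemma rootprod_interior w (s : seq R[i]) (h : R) : 0 < h ->
  (forall x, x \in w :: s -> complex.Im x <= - h) ->
  interior 0 (size s) (map_poly (@complex.Re R) (rootprod (w :: s)))
    (map_poly (@complex.Im R) (rootprod (w :: s))).
Proof.
move=> h0 H; have [|c c0 cP] := @rootprod_lower_bound R 0 s.
  by move=> x xs; rewrite (le_lt_trans (H x _)) ?oppr_lt0// inE xs orbT.
exists (h * c); first exact: mulr_gt0.
move=> z z0; have := @rootprod_conj_lt R w s z z0.
rewrite -poly_star_rootprod -wr_map_poly.
have sI x : x \in w :: s -> complex.Im x <= 0.
  by move=> /H/le_trans-> //; rewrite oppr_le0 ltW.
move=> /(_ sI); have := cP z z0; rewrite /weight.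
set B := normc (rootprod s).[z] ^+ 2; set N := (1 + _) ^+ _; set W := wr _ _ _ => cN.
have hw := H w (mem_head _ _).
have B0 : 0 <= B by exact: sqr_ge0.
have := ler_wpM2l (mulr_ge0 (ltW h0) (ltW z0)) cN.
have := mulr_ge0 (mulr_ge0 (ltW z0) B0) (_ : 0 <= - h - complex.Im w).
rewrite subr_ge0 => /(_ hw); lra.
Qed.

(** The zeros w of u + iv, none of them in the open upper half-plane, move along (1 - t) w - t i to
    - i; at time t all have imaginary part at most - t. *)
Lemma interior_path_halfplane m u v : hb_pair 0 u v ->
  (size u <= m.+2)%N -> (size v <= m.+2)%N ->
  (u`_m.+1 != 0) || (v`_m.+1 != 0) ->
  interior_path 0 m u v
    (map_poly (@complex.Re R) (rootprod (nseq m.+1 (0 -i* 1))))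
    (map_poly (@complex.Im R) (rootprod (nseq m.+1 (0 -i* 1)))).
Proof.
move=> uv su sv uv0; pose P := cpoly u v.
have Pc : P`_m.+1 = u`_m.+1 +i* v`_m.+1.
  by rewrite coefD coefZ !coef_map; simpc.
have Pc0 : P`_m.+1 != 0 by rewrite Pc eq_complex /= negb_and.
have sP : size P = m.+2.
  apply/eqP; rewrite eqn_leq; apply/andP; split; last first.
    by rewrite ltnNge; apply: contraNN Pc0 => sP; rewrite nth_default.
  rewrite (leq_trans (size_polyD _ _))// geq_max size_map_poly su /=.
  by rewrite (leq_trans (size_scale_leq _ _))// size_map_poly.
have [s sE] := closed_field_poly_normal P.
have lP : lead_coef P = P`_m.+1 by rewrite lead_coefE sP.
have ss : size s = m.+1.
  have := sP; rewrite sE size_scale ?lead_coef_eq0; last first.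
    by apply: contraNneq Pc0 => ->; rewrite coef0.
  by rewrite size_prod_XsubC => -[].
have sI w : w \in s -> complex.Im w <= 0.
  move=> ws; rewrite leNgt; apply/negP => w0.
  have P0 : P = 0.
    apply: hb_pair_root uv w0 _; rewrite -horner_cpoly -/P sE hornerZ.
    have -> : (\prod_(x <- s) ('X - x%:P)).[w] = 0.
      by apply/eqP; rewrite -/(root _ w) root_prod_XsubC.
    by rewrite mulr0.
  by move: Pc0; rewrite P0 coef0 eqxx.
(* Rotation by c makes u + iv monic, hence determined by its zeros. *)
pose c := (P`_m.+1)^-1.
pose f (t : R) (w : R[i]) : R[i] := (1 - t)%:C * w - t%:C * 'i.
have f0 w : f 0 w = w by rewrite /f subr0 mul1r mul0r subr0.
have f1 w : f 1 w = 0 -i* 1 by rewrite /f subrr mul0r mul1r; simpc.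
have fs0 : map (f 0) s = s by rewrite -[RHS]map_id; apply: eq_map.
have fs1 : map (f 1) s = nseq m.+1 (0 -i* 1).
  by rewrite -ss; elim: (s) => //= x r ->; rewrite f1.
have cP : rootprod s = cpoly (complex.Re c *: u - complex.Im c *: v)
    (complex.Im c *: u + complex.Re c *: v).
  rewrite cpoly_rot -/P (_ : _ +i* _ = c); last by case: (c).
  by rewrite sE scalerA lP /c mulVf// scale1r.
exists (fun t => map_poly (@complex.Re R) (rootprod (map (f t) s))),
  (fun t => map_poly (@complex.Im R) (rootprod (map (f t) s))),
  (complex.Re c), (complex.Im c).
have fc w t : {for t, continuous (fun t => f t w : C)}.
  rewrite /f.
  have c1 : {for t, continuous (fun t : R => (1 - t)%:C * w : C)}.
    apply: (@continuousM R[i] R); last exact: cst_continuous.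
    exact: (continuous_comp (@continuous_subr1 t) (@continuous_real_complex _ _)).
  have c2 : {for t, continuous (fun t : R => t%:C * 'i : C)}.
    apply: (@continuousM R[i] R); last exact: cst_continuous.
    exact: continuous_real_complex.
  exact: (continuousB c1 c2).
have Pcont := @continuous_rootprod_coef f s fc.
split; split => //.
- have : c != 0 by rewrite invr_eq0.
  by rewrite eq_complex negb_and.
- by rewrite fs0 cP map_ReK.
- by rewrite fs0 cP map_ImK.
- by rewrite fs1.
- by rewrite fs1.
- move=> t i.
  have -> : (fun s0 => (map_poly (@complex.Re R) (rootprod (map (f s0) s)))`_i) =
     (@complex.Re R : C -> R) \o (fun t => (rootprod (map (f t) s))`_i : C).
    by apply/funext => x; rewrite coef_map_id0.
  exact: (continuous_comp (Pcont i t) (@continuous_Re _ _)).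
- move=> t i.
  have -> : (fun s0 => (map_poly (@complex.Im R) (rootprod (map (f s0) s)))`_i) =
     (@complex.Im R : C -> R) \o (fun t => (rootprod (map (f t) s))`_i : C).
    by apply/funext => x; rewrite coef_map_id0.
  exact: (continuous_comp (Pcont i t) (@continuous_Im _ _)).
- move=> t /andP[t0 t1].
  have sz : size (rootprod (map (f t) s)) = m.+2.
    by rewrite /rootprod size_prod_XsubC size_map ss.
  split; [by rewrite -sz size_poly|by rewrite -sz size_poly|].
  case: s ss sI {sE fs0 fs1 cP Pcont sz} => // w s [<-] sI.
  rewrite -(size_map (f t) s); apply: (rootprod_interior t0) => x.
  rewrite -[_ :: _]/(map (f t) (w :: s)) => /mapP[y /sI yI ->].
  rewrite /f; case: (y) yI => y1 y2 /= y0.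
  have := mulr_ge0_le0 (_ : 0 <= 1 - t) y0; rewrite subr_ge0 => /(_ t1); lra.
Qed.

(** E and F come before u and v: all paths share the endpoint with which signs are compared. *)
Lemma interior_path_exists mu m : 0 <= mu -> exists E F, forall u v,
  hb_pair mu u v -> (size u <= m.+2)%N -> (size v <= m.+2)%N ->
  (u`_m.+1 != 0) || (v`_m.+1 != 0) -> interior_path mu m u v E F.
Proof.
rewrite le_eqVlt => /predU1P[<-|mu0].
  by eexists; eexists => u v; exact: interior_path_halfplane.
by eexists; eexists => u v; exact: interior_path_strip.
Qed.

End Paths.
(** * Preservers *)

Section Preservers.
Variables (R : realType) (mu : R) (n : nat).
Variable T : {linear {poly_n.+1 R} -> {poly R}}.
Hypothesis mu0 : 0 <= mu.
Implicit Types (z : R[i]) (u v p q r : {poly R}) (m : nat).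

Definition zero_or_zfree p := p = 0 \/ zfree mu p.

Definition zfree_preserver := forall q, (size q <= n.+1)%N ->
  zero_or_zfree q -> zero_or_zfree (trunc_op T q).

Lemma zero_or_zfreeZ (a : R) p : a != 0 ->
  zero_or_zfree (a *: p) -> zero_or_zfree p.
Proof.
move=> a0 [/eqP|pf]; [rewrite scaler_eq0 (negbTE a0) /= => /eqP ->; by left|right].
by move=> z /pf; apply: contraNneq => pz; rewrite cevZ pz mulr0.
Qed.

Lemma zero_or_zfree_root p z : mu < complex.Im z -> zero_or_zfree p ->
  cev p z = 0 -> p = 0.
Proof. by move=> muz [//|/(_ z muz)/eqP]. Qed.

Lemma pencil_trunc_op u v : zfree_preserver ->
  (size u <= n.+1)%N -> (size v <= n.+1)%N ->
  pencil_zfree mu u v -> pencil_zfree mu (trunc_op T u) (trunc_op T v).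
Proof.
move=> H su sv uv a b; rewrite -!trunc_opZ -trunc_opD.
by apply: H; [exact: size_lin2|exact: uv].
Qed.

(** If [wr] vanished, a real combination of T u and T v would vanish at z, hence be 0, so T would
    kill some q = a u + b v. Since q + e r is zero-free for a small e, T r = T (q + e r) / e would
    be 0 or zero-free, against the choice of r. *)
Lemma interior_trunc_op_neq0 m u v z : n = m.+1 -> zfree_preserver ->
  (exists2 r : {poly R}, (size r <= n.+1)%N & ~ zero_or_zfree (trunc_op T r)) ->
  (size u <= n.+1)%N -> (size v <= n.+1)%N -> interior mu m u v ->
  mu < complex.Im z -> wr (trunc_op T u) (trunc_op T v) z != 0.
Proof.
move=> nm H [r sr nr] su sv uv muz; apply/negP => /eqP W; apply: nr.
have [a [b [ab E]]] := wr_eq0_root W.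
have [hp _] : hb_pair mu u v.
  by apply: strict_hb_pair => x; exact: interior_gt0 mu0 uv.
have Tq : trunc_op T (a *: u + b *: v) = 0.
  apply: zero_or_zfree_root muz _ _; last by rewrite trunc_opD !trunc_opZ.
  by apply: H; [exact: size_lin2|exact: hp].
have [c c0 uvc] := uv.
(* Rotating the pair makes a u + b v its first member. *)
have I : interior mu m (a *: u - (- b) *: v) (- b *: u + a *: v).
  exists ((a ^+ 2 + (- b) ^+ 2) * c).
    rewrite mulr_gt0// lt_neqAle addr_ge0 ?sqr_ge0// andbT eq_sym.
    by rewrite paddr_eq0 ?sqr_ge0// !expf_eq0 /= oppr_eq0 negb_and.
  by move=> x mux; rewrite wr_rot -mulrA ler_wpM2l ?uvc// addr_ge0// sqr_ge0.
rewrite nm in su sv sr.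
have [e e0 qf] := interior_perturb (r := r) mu0 I (size_lin2 _ _ su sv) sr.
rewrite scaleNr opprK in qf.
apply: (@zero_or_zfreeZ e); first exact: lt0r_neq0.
have -> : e *: trunc_op T r = trunc_op T (a *: u + b *: v + e *: r).
  by rewrite trunc_opD Tq add0r trunc_opZ.
apply: H; last by right.
by rewrite nm -[_ + b *: v]scale1r size_lin2// size_lin2.
Qed.

(** The new pair is (u + iv)(1 - i e X), for which [wr] is strictly positive above mu. *)
Lemma hb_pair_raise (e : R) u v : hb_pair mu u v -> cpoly u v != 0 -> 0 < e ->
  hb_pair mu (u + e *: ('X * v)) (v - e *: ('X * u)).
Proof.
move=> uv P0 e0; apply: strict_hb_pair => z muz.
pose A := cev u z; pose B := cev v z; pose w := e%:C * z.
have z0 : 0 < complex.Im z by exact: le_lt_trans muz.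
have U1 : cev (u + e *: ('X * v)) z + 'i * cev (v - e *: ('X * u)) z =
    (A + 'i * B) * (1 - 'i * w).
  rewrite !cevD cevN !cevZ !cevM cevX -/A -/B /w.
  by case: (A) (B) (z) => [? ?] [? ?] [? ?]; simpc; congr (_ +i* _); ring.
have U2 : cev (u + e *: ('X * v)) z - 'i * cev (v - e *: ('X * u)) z =
    (A - 'i * B) * (1 + 'i * w).
  rewrite !cevD cevN !cevZ !cevM cevX -/A -/B /w.
  by case: (A) (B) (z) => [? ?] [? ?] [? ?]; simpc; congr (_ +i* _); ring.
have := cpoly_normE (cev (u + e *: ('X * v)) z) (cev (v - e *: ('X * u)) z).
rewrite U1 U2 !normcM !exprMn -/(wr _ _ z).
have := cpoly_normE A B; rewrite -/(wr u v z); have := uv.2 z muz.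
have AB : 0 < normc (A + 'i * B) ^+ 2.
  rewrite exprn_gt0// normc_gt0; apply: contra_neq P0.
  exact: hb_pair_root uv muz.
have ww : normc (1 - 'i * w) ^+ 2 - normc (1 + 'i * w) ^+ 2 = 4 * (e * complex.Im z).
  by rewrite /w !normc_sqrE; case: (z) => x y /=; ring.
have ez : 0 < e * complex.Im z by rewrite mulr_gt0.
(* In these names 4 W' = a c - b d, whence W' = W d + a f. *)
move: AB ww ez; set a := normc _ ^+ 2; set b := normc (A - _) ^+ 2.
set c := normc _ ^+ 2; set d := normc _ ^+ 2; set f := _ * complex.Im z.
have d0 : 0 <= d by exact: sqr_ge0.
move: (wr u v z) (wr (u + _) _ z) => W W' a0 cd f0 W0 ab E.
have cE : c = d + 4 * f by lra.
have aE : a = b + 4 * W by lra.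
have : 0 < a * f by rewrite mulr_gt0.
have : 0 <= W * d by rewrite mulr_ge0.
rewrite cE in E; have : a * d = b * d + 4 * (W * d) by rewrite aE; ring.
lra.
Qed.

Lemma zfreeXn k : zfree mu ('X^k : {poly R}).
Proof.
move=> z muz; rewrite /cev /polyC_of map_polyXn hornerXn expf_neq0//.
by apply: contraTneq muz => ->; rewrite -leNgt.
Qed.

(** On images of interior pairs [wr] never vanishes at z, so along each path it keeps the sign it
    has at the endpoint (E, F), whose value serves as s. Pairs of lower degree are limits of pairs
    of degree n. *)
Lemma sign_const (m : nat) z : n = m.+1 -> zfree_preserver ->
  (exists2 r : {poly R}, (size r <= n.+1)%N & ~ zero_or_zfree (trunc_op T r)) ->
  mu < complex.Im z ->
  exists2 s : R, s != 0 & forall u v, (size u <= n.+1)%N -> (size v <= n.+1)%N ->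
    hb_pair mu u v -> 0 <= s * wr (trunc_op T u) (trunc_op T v) z.
Proof.
move=> nm H nr muz; pose sg u v := wr (trunc_op T u) (trunc_op T v) z.
have [E [F EF]] := @interior_path_exists R mu m mu0.
have In0 u v : (size u <= n.+1)%N -> (size v <= n.+1)%N -> interior mu m u v ->
  sg u v != 0 by move=> su sv uv; exact: interior_trunc_op_neq0 nm H nr su sv uv muz.
(* The path issuing from (X^(m+1), 0) shows that (E, F) is interior. *)
have s0 : sg E F != 0.
  have hbX : hb_pair mu 'X^(m.+1) 0.
    by apply: hb_pair0; right; exact: zfreeXn.
  have [|||U [V [a [b [_ [<- <- _ _ /(_ 1)]]]]]] := EF _ _ hbX.
  - by rewrite size_polyXn.
  - by rewrite size_poly0.
  - by rewrite coefXn eqxx oner_neq0.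
  by rewrite ltr01 lexx -nm => /(_ isT)[]; exact: In0.
exists (sg E F) => //.
have top u v : (size u <= n.+1)%N -> (size v <= n.+1)%N -> hb_pair mu u v ->
    (u`_n != 0) || (v`_n != 0) -> 0 <= sg E F * sg u v.
  rewrite nm => su sv uv uv0.
  have [U [V [a [b [[ab U0 V0] [U1 V1 Uc Vc UV]]]]]] := EF u v uv su sv uv0.
  have fc : continuous (fun t => sg (U t) (V t)).
    by move=> t; apply: continuous_wr_trunc_op => i; [exact: Uc|exact: Vc].
  have D0 : 0 < a ^+ 2 + b ^+ 2.
    rewrite lt_neqAle addr_ge0 ?sqr_ge0// andbT eq_sym.
    by rewrite paddr_eq0 ?sqr_ge0// !expf_eq0 /= negb_and.
  have f0 : sg (U 0) (V 0) = (a ^+ 2 + b ^+ 2) * sg u v.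
    by rewrite U0 V0 /sg trunc_opB trunc_opD !trunc_opZ wr_rot.
  rewrite leNgt; apply/negP => lt0.
  (* The zero so found is at t > 0, since at 0 the value is a positive multiple of [sg u v], which
     is not 0 here. *)
  have [||t] := @IVT _ (fun t => sg (U t) (V t)) 0 1 0 ler01.
  - exact: continuous_subspaceT.
  - rewrite f0 U1 V1 ge_min le_max.
    have [s1|s1] := ltP 0 (sg E F).
      have u1 : sg u v <= 0 by move: lt0; rewrite pmulr_rlt0// => /ltW.
      by rewrite (ltW s1) orbT mulr_ge0_le0// ltW.
    have sn : sg E F < 0 by rewrite lt_neqAle s0.
    have u1 : 0 <= sg u v by move: lt0; rewrite nmulr_rlt0// => /ltW.
    by rewrite ?s1 orbT mulr_ge0// ltW.
  rewrite in_itv /= => /andP[t0 t1] ft.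
  have tp : 0 < t.
    rewrite lt_neqAle t0 andbT; apply: contraTneq lt0 => tE.
    move: ft; rewrite -tE f0 => /eqP; rewrite mulf_eq0 (gt_eqF D0) /= => /eqP ->.
    by rewrite mulr0 ltxx.
  have [|sU sV /In0] := UV t; first by rewrite tp t1.
  by rewrite nm ft eqxx => /(_ sU sV).
(* Induction on the defect j = n - k of the degree: the pair is multiplied by 1 - i e X, and e tends
   to 0. *)
have D j : forall k u v, (k + j = n)%N -> (size u <= k.+1)%N ->
    (size v <= k.+1)%N -> (u`_k != 0) || (v`_k != 0) ->
    hb_pair mu u v -> 0 <= sg E F * sg u v.
  elim: j => [k u v|j IH k u v kj su sv uv0 uv].
    by rewrite addn0 => -> su sv uv0 uv; exact: top.
  pose U (e : R) := u + e *: ('X * v); pose V (e : R) := v - e *: ('X * u).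
  have cc (p q : {poly R}) i : continuous (fun e : R => (p + e *: q)`_i).
    move=> t; have -> : (fun e : R => (p + e *: q)`_i) = (fun e => p`_i + e * q`_i).
      by apply/funext => e; rewrite coefD coefZ.
    have pc : {for t, continuous (fun=> p`_i : R)} by exact: cst_continuous.
    have qc : {for t, continuous (fun e : R => e * q`_i)}.
      by apply: continuousM => //; exact: cst_continuous.
    exact: (continuousD pc qc).
  have gc : continuous (fun e => sg E F * sg (U e) (V e)).
    move=> t; apply: continuousM; first exact: cst_continuous.
    apply: continuous_wr_trunc_op => i; first exact: cc.
    have -> : (fun e => (V e)`_i) = (fun e => (v + e *: - ('X * u))`_i).
      by apply/funext => e; rewrite scalerN.
    exact: cc.
  have pos e : 0 < e -> 0 <= sg E F * sg (U e) (V e).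
    move=> e0; have sX (p q : {poly R}) (x : R) : (size p <= k.+1)%N ->
        (size q <= k.+1)%N -> (size (p + x *: ('X * q))%R <= k.+2)%N.
      move=> sp sq; rewrite -[p]scale1r size_lin2 ?(leq_trans sp)//.
      by rewrite (leq_trans (size_polyMleq _ _))// size_polyX.
    apply: (IH k.+1); rewrite ?addSnnS//; first exact: sX.
    - by rewrite /V -scaleNr; exact: sX.
    (* In degree k + 1 the coefficients are e v_k and - e u_k, so the degree has really
       increased. *)
    - have [uk vk] : u`_k.+1 = 0 /\ v`_k.+1 = 0 by split; exact: nth_default.
      rewrite /U /V coefD coefB !coefZ !coefXM /= uk vk add0r sub0r oppr_eq0.
      by rewrite !mulf_eq0 (gt_eqF e0) /= orbC.
    - apply: hb_pair_raise => //; apply: contraTneq uv0 => P0.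
      have := congr1 (fun P : {poly R[i]} => P`_k) P0.
      rewrite coef0 coefD coefZ !coef_map; simpc => -[-> ->].
      by rewrite eqxx.
  rewrite leNgt; apply/negP => lt0.
  have lt0' : sg E F * sg (U 0) (V 0) < 0.
    by rewrite /U /V !scale0r addr0 subr0.
  have gr := cvg_at_right_filter (gc 0).
  have : \forall e \near 0^'+, sg E F * sg (U e) (V e) < 0 by exact: cvgr_lt gr _ lt0'.
  move=> /(filterI (nbhs_right_gt 0)) /filter_ex[e [/= /pos e0]].
  by rewrite ltNge e0.
move=> u v su sv uv.
have [uv0|] := posnP (maxn (size u) (size v)).
  have -> : u = 0 by apply/eqP; rewrite -size_poly_eq0 -leqn0 -uv0 leq_maxl.
  by rewrite /sg trunc_op0 /wr cev0 mul0r mulr0.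
case kE : (maxn _ _) => [//|k] _.
have kn : (k <= n)%N by rewrite -ltnS -kE geq_max su.
apply: (D (n - k)%N k) => //; first exact: subnKC.
- by rewrite -kE leq_maxl.
- by rewrite -kE leq_maxr.
move: kE; rewrite /maxn; case: ltnP => _ sk; apply/orP; [right|left].
  by have := lead_coef_eq0 v; rewrite lead_coefE sk /= => ->; rewrite -size_poly_eq0 sk.
by have := lead_coef_eq0 u; rewrite lead_coefE sk /= => ->; rewrite -size_poly_eq0 sk.
Qed.

End Preservers.

(** * Operators with every image zero or zero-free: rank at most 2 *)

Section SmallImage.
Variables (R : realType) (n : nat) (T : {linear {poly_n.+1 R} -> {poly R}}).
Implicit Types (z : R[i]) (p q : {poly_n.+1 R}).

(** As c varies, Re (c w) runs through all real-linear functionals of w = T p (z), so real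
    coordinates of this value have this form. *)
Definition eval_functional (z c : R[i]) p : R :=
  complex.Re (c * cev (T p) z).

Lemma eval_functional_is_scalar z c : scalar (eval_functional z c).
Proof.
move=> a p q; rewrite /eval_functional linearP /= cevD cevZ.
by case: c (cev (T p) z) (cev (T q) z) => [? ?] [? ?] [? ?] /=; ring.
Qed.

HB.instance Definition _ z c := GRing.isLinear.Build R {poly_n.+1 R} R *%R
  (eval_functional z c) (eval_functional_is_scalar z c).

Definition scalar_functional z c : {scalar {poly_n.+1 R}} := eval_functional z c.

Variables (mu : R) (z : R[i]).
Hypothesis muz : mu < complex.Im z.
Hypothesis imT : forall p, zero_or_zfree mu (T p).

Lemma image_eq0 p : cev (T p) z = 0 -> T p = 0.
Proof. exact: zero_or_zfree_root muz (imT p). Qed.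

(** Evaluation at z embeds the image in the complex plane, of real dimension 2: the 3 x 2 matrix of
    real and imaginary parts has a nonzero left kernel. *)
Lemma small_image_rank : rank_at_most T 2.
Proof.
move=> u; pose M : 'M[R]_(3, 2) := \matrix_(i, j)
  (if j == 0 then complex.Re (cev (T (u i)) z) else complex.Im (cev (T (u i)) z)).
have kM : kermx M != 0.
  rewrite -mxrank_eq0 mxrank_ker -lt0n subn_gt0.
  by rewrite (leq_ltn_trans (rank_leq_col M)).
pose c := nz_row (kermx M).
have cM : c *m M = 0 by apply/sub_kermxP; exact: nz_row_sub.
exists (fun i => c 0 i).
  have : c != 0 by rewrite nz_row_eq0.
  move=> /rV0Pn[i ci]; by exists i.
rewrite -[LHS]/(\sum_i c 0 i *: T (u i)).
have -> : \sum_i c 0 i *: T (u i) = T (\sum_i c 0 i *: u i).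
  by rewrite linear_sum; apply: eq_bigr => i _; rewrite linearZ.
apply: image_eq0; rewrite linear_sum /= cev_sum.
have E j : \sum_i c 0 i * M i j = 0.
  by have := congr1 (fun A : 'M[R]_(1, 2) => A 0 j) cM; rewrite !mxE.
have Re_sum (F : 'I_3 -> R[i]) : complex.Re (\sum_i F i) = \sum_i complex.Re (F i).
  by elim/big_rec2: _ => // i x y _ <-; case: (F i) y => [? ?] [? ?].
have Im_sum (F : 'I_3 -> R[i]) : complex.Im (\sum_i F i) = \sum_i complex.Im (F i).
  by elim/big_rec2: _ => // i x y _ <-; case: (F i) y => [? ?] [? ?].
apply/eqP; rewrite eq_complex Re_sum Im_sum; apply/andP; split; apply/eqP.
  rewrite -[RHS](E 0); apply: eq_bigr => i _.
  by rewrite !mxE linearZ cevZ; case: (cev _ z) => ? ? /=; ring.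
rewrite -[RHS](E 1); apply: eq_bigr => i _.
by rewrite !mxE linearZ cevZ; case: (cev _ z) => ? ? /=; ring.
Qed.

Lemma image_span p p1 p2 (a b : R) :
  cev (T p) z = a%:C * cev (T p1) z + b%:C * cev (T p2) z ->
  T p = a *: T p1 + b *: T p2.
Proof.
move=> E; apply/eqP; rewrite -subr_eq0 -!linearZ -linearD -linearB; apply/eqP.
by apply: image_eq0; rewrite linearB linearD !linearZ /= cevD cevN cevD !cevZ E subrr.
Qed.

(** The values T p (z) fill the plane, a real line or 0. In the first case two images with positive
    [wr] serve as Q and S, in the second one image and 0, in the last 0 twice. *)
Lemma small_image_form : exists (alpha beta : {scalar {poly_n.+1 R}}) (Q S : {poly R}),
  (forall p, T p = alpha p *: Q + beta p *: S) /\ hb_pair mu Q S.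
Proof.
have imT2 p q : pencil_zfree mu (T p) (T q).
  by move=> a b; rewrite -!linearZ -linearD; exact: imT.
have [[p1 [p2 W0]]|noW] := pselect (exists p1 p2, 0 < wr (T p1) (T p2) z).
  set W := wr (T p1) (T p2) z in W0.
  case xE : (cev (T p1) z) => [x1 y1]; case yE : (cev (T p2) z) => [x2 y2].
  (* Cramer's rule for the coordinates of T p (z) in the basis of the two values. *)
  exists (scalar_functional z (- (y2 / W) -i* (x2 / W))),
    (scalar_functional z ((y1 / W) +i* (x1 / W))), (T p1), (T p2).
  split=> [p|]; last by apply: pencil_hb_pair muz _ _ => //; rewrite ltW.
  apply: image_span; rewrite /= /eval_functional xE yE; case: (cev (T p) z) => x y.
  have WE : W = y1 * x2 - x1 * y2 by rewrite /W /wr xE yE /=; ring.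
  have {}W0 : y1 * x2 - x1 * y2 != 0 by rewrite -WE lt0r_neq0.
  apply/eqP; rewrite WE eq_complex /=; apply/andP; split; apply/eqP; field; exact: W0.
have wr0 p q : wr (T p) (T q) z = 0.
  apply/eqP; rewrite eq_le; apply/andP; split; rewrite leNgt; apply/negP => W0.
    by apply: noW; exists p, q.
  by apply: noW; exists q, p; rewrite wrC oppr_gt0.
have [[p1 /eqP p10]|noT] := pselect (exists p, T p <> 0).
  have : cev (T p1) z != 0 by apply: contra_neq p10 => /image_eq0.
  case xE : (cev (T p1) z) => [x1 y1]; rewrite -normc_gt0 => N0.
  pose N := x1 ^+ 2 + y1 ^+ 2.
  have {}N0 : N != 0 by rewrite /N -(normc_sqrE (x1 +i* y1)) expf_neq0 ?lt0r_neq0.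
  (* Orthogonal projection onto the line of T p1 (z). *)
  exists (scalar_functional z ((x1 / N) -i* (y1 / N))), (scalar_functional z 0),
    (T p1), 0; split=> [p|]; last exact/hb_pair0/imT.
  rewrite scaler0 addr0 -[RHS]addr0 -[X in _ + X](scale0r (T p1)).
  apply: image_span; rewrite /= /eval_functional xE mul0r addr0.
  have := wr0 p p1; rewrite /wr xE; case: (cev (T p) z) => x y /= xy.
  have {}xy : x * y1 = y * x1 by lra.
  apply/eqP; rewrite eq_complex /=; apply/andP; split; apply/eqP; apply: (mulIf N0).
    transitivity (x1 ^+ 2 * x + y1 * (y * x1)); last by field.
    by rewrite -xy /N; ring.
  transitivity (x1 * (x * y1) + y1 ^+ 2 * y); last by field.
  by rewrite xy /N; ring.
have T0 p : T p = 0 by apply: contrapT => Tp; apply: noT; exists p.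
exists (scalar_functional z 0), (scalar_functional z 0), 0, 0; split=> [p|].
  by rewrite T0 !scaler0 addr0.
by apply: hb_pair0; left.
Qed.

End SmallImage.

Theorem proposition3p10 (R : realType) (mu : R) (n : nat)
    (T : {linear {poly_n.+1 R} -> {poly R}}) (mu_ge0 : 0 <= mu) :
  (forall p : {poly_n.+1 R}, classSR mu p -> (classSR mu `|` [set 0]) (T p))
  <->
  ((rank_at_most T 2 /\
    exists (alpha beta : {scalar {poly_n.+1 R}}) (Q S : {poly R}),
      (forall p : {poly_n.+1 R}, T p = alpha p *: Q + beta p *: S) /\
      classP mu (polyC_of Q + 'i%C *: polyC_of S))
   \/
   ((forall p : {poly_n.+1 R[i]}, classP mu p -> classP mu (extend T p)) \/
    (forall p : {poly_n.+1 R[i]},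
       classP mu p -> set_star (classP mu) (extend T p)))).
Proof.
pose z : R[i] := 0 +i* (mu + 1).
have muz : mu < complex.Im z by rewrite ltrDl.
(* A real p of S_mu gives p + i 0 in P_mu, with image T p + i 0: both inclusions of (ii) thus speak
   about T p. *)
have real_extend (p : {poly_n.+1 R}) : classSR mu p ->
    exists2 P : {poly_n.+1 R[i]}, classP mu P & extend T P = cpoly (T p) 0.
  move=> pS; have sp : (size (cpoly p 0) <= n.+1)%N.
    rewrite /cpoly /polyC_of rmorph0 scaler0 addr0 size_map_poly.
    exact: size_npoly.
  exists (npolyp n.+1 (cpoly p 0)).
    rewrite npolypK//; apply: hb_pair_classP => //; apply: hb_pair0.
    by apply/(classSR0P _ mu_ge0); left.
  rewrite (@extend_cpoly _ _ _ p 0) ?npolypK ?size_npoly ?size_poly0//.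
  by rewrite trunc_opE trunc_op0.
have real_hb u : hb_pair mu u 0 -> (classSR mu `|` [set 0]) u.
  move=> [uv _]; apply/(classSR0P _ mu_ge0); have := uv 1 0.
  by rewrite scale1r scaler0 addr0.
split=> [H|[[_ [alpha [beta [Q [S [TE QS]]]]]]|[H|H]] p pS]; last first.
(* Conjugating coefficients is an involution that fixes T p, so T p is itself in P_mu. *)
- have [P PP PE] := real_extend p pS; have [r rP rE] := H P PP.
  apply: real_hb; apply: classP_hb; move: rP; rewrite PE in rE.
  have -> : r = cpoly (T p) 0 => //.
  have := congr1 (@poly_star R) rE.
  rewrite poly_star_cpoly oppr0 => <-; apply/polyP => i.
  by rewrite !coef_map /= conjcK.
- have [P PP PE] := real_extend p pS.
  by apply: real_hb; apply: classP_hb; rewrite -PE; exact: H.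
- apply/(classSR0P _ mu_ge0); rewrite TE.
  by have [QSp _] := classP_hb (QS : classP mu (cpoly Q S)); exact: QSp.
have pres : zfree_preserver mu T.
  move=> q sq [->|qf]; first by rewrite trunc_op0; left.
  have qE : npolyp n.+1 q = q :> {poly R} by rewrite npolypK.
  apply/(classSR0P _ mu_ge0); apply: H; rewrite qE.
  have [//|q0] : (classSR mu `|` [set 0]) q by apply/(classSR0P _ mu_ge0); right.
  by move: (zfree_neq0 qf); rewrite q0 eqxx.
(* Either every image is 0 or zero-free, which yields (i), or some r has another kind of image,
   which yields (ii). *)
have [imT|] := pselect (forall p, zero_or_zfree mu (T p)).
  left; split; first exact: small_image_rank muz imT.
  have [alpha [beta [Q [S [TE QS]]]]] := small_image_form muz imT.
  by exists alpha, beta, Q, S; split => //; exact: hb_pair_classP.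
move=> /existsNP[r nr]; right.
have nr' : exists2 r : {poly R}, (size r <= n.+1)%N & ~ zero_or_zfree mu (trunc_op T r).
  by exists r; rewrite ?trunc_opE// size_npoly.
(* For n = 0 every image is a multiple of T 1, so r could not exist. *)
have [m nm] : exists m, n = m.+1.
  case: (n) T r nr pres {H nr' real_extend} => [|m] T' r nr pres; last by exists m.
  exfalso; apply: nr; rewrite -trunc_opE.
  have -> : (r : {poly R}) = r`_0 *: 1 by rewrite alg_polyC; exact/size1_polyC/size_npoly.
  have := pres 1; rewrite size_poly1 => /(_ isT).
  have oneP : zero_or_zfree mu (1 : {poly R}) by right; exact: (zfreeXn mu_ge0 0).
  move=> /(_ oneP) T1; rewrite trunc_opZ.
  case: T1 => [->|T1]; first by rewrite scaler0; left.
  have [->|r0] := eqVneq (r`_0) 0; first by rewrite scale0r; left.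
  by right => x /T1 Tx; rewrite cevZ mulf_neq0// (fmorph_eq0 (real_complex R)).
have [s s0 sP] := sign_const mu_ge0 nm pres nr' muz.
have decomp (P : {poly_n.+1 R[i]}) : classP mu P -> exists u v,
    [/\ P = cpoly u v :> {poly R[i]}, (size u <= n.+1)%N, (size v <= n.+1)%N &
    hb_pair mu u v].
  move=> PP; exists (map_poly (@complex.Re R) P), (map_poly (@complex.Im R) P).
  rewrite cpoly_ReIm; split => //; [| |by apply: classP_hb; rewrite cpoly_ReIm].
    by rewrite (leq_trans (size_poly _ _))// size_npoly.
  by rewrite (leq_trans (size_poly _ _))// size_npoly.
(* The sign of s decides between P_mu and its conjugate class. *)
have [sp|sn] := ltP 0 s; [left|right] => P /decomp[u [v [PE su sv uv]]].
  rewrite (extend_cpoly T su sv PE); apply: hb_pair_classP => //.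
  apply: pencil_hb_pair muz _ _; first exact: pencil_trunc_op pres su sv uv.1.
  by have := sP u v su sv uv; rewrite pmulr_rge0.
have {}sn : s < 0 by rewrite lt_neqAle s0.
exists (cpoly (trunc_op T u) (- trunc_op T v)).
  apply: hb_pair_classP => //.
  apply: pencil_hb_pairN muz _ _; first exact: pencil_trunc_op pres su sv uv.1.
  by have := sP u v su sv uv; rewrite nmulr_rge0.
by rewrite poly_star_cpoly opprK (extend_cpoly T su sv PE).
Qed.
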